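(* Let $g:[-1,1]\to\mathbb{R}$ be a nonnegative smooth function, let $\omega>0$, and let $\phi_\omega(x)=\sin(\omega x)$ or $\phi_\omega(x)=\cos(\omega x)$, with the weight $W_\omega(x):=(g\circ\phi_\omega)(x)$ not almost everywhere zero on $[-1,1]$. For $n\ge 0$, let $\{x_k,w_k\}_{k=1}^n$ be the $n$-point Gaussian quadrature rule for the weight $W_\omega$ on $[-1,1]$ (the nodes $x_k$ are the zeros of the degree-$n$ polynomial orthogonal with respect to $W_\omega$ on $[-1,1]$, and the weights $w_k$ are such that the rule is exact for all polynomials of degree at most $2n-1$; for $n=0$ the rule is the empty sum), and define the remainder $$R_n[f]=\int_{-1}^1 f(x)\,(g\circ\phi_\omega)(x)\,dx-\sum_{k=1}^n w_k f(x_k).$$ Let $\mathcal{K}_\omega=\int_{-1}^1 (g\circ\phi_\omega)(x)\,dx$. (i) If $f$ is analytic with $|f(z)|\le M_\rho$ in the region bounded by the ellipse with foci $\pm1$ and major and minor semiaxis lengths summing to $\rho>1$, then for each $n\ge 0$, $$|R_n[f]|\le \frac{4\mathcal{K}_\omega M_\rho}{\rho^{2n}(1-\rho^{-1})}.$$ (ii) If for some $m\in\mathbb{N}$ the functions $f,f',\ldots,f^{(m-1)}$ are absolutely continuous on $[-1,1]$ and $f^{(m)}$ is of bounded variation with total variation $V_m$, then for each $n\ge\lfloor (m+2)/2\rfloor$, $$|R_n[f]|\le \frac{4\mathcal{K}_\omega V_m}{\pi m (2n-1)(2n-2)\cdots(2n-m)}.$$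
   Context: Gaussian quadrature with respect to a nonnegative weight: nodes are the zeros of the orthogonal polynomial of degree $n$ (they lie in $(-1,1)$), weights are positive, and the rule integrates exactly all polynomials of degree at most $2n-1$. *)

(* Defs.v *)
From Stdlib Require Import Reals Lra.
From Coquelicot Require Import Coquelicot.
Open Scope R_scope.

Definition I11 (x : R) : Prop := -1 <= x <= 1.

Fixpoint sumlt (n : nat) (f : nat -> R) : R :=
  match n with
  | O => 0
  | S m => sumlt m f + f m
  end.

Fixpoint Csumlt (n : nat) (f : nat -> C) : C :=
  match n with
  | O => RtoC 0
  | S m => (Csumlt m f + f m)%C
  end.

Fixpoint prod1 (m : nat) (f : nat -> R) : R :=
  match m with
  | O => 1
  | S k => prod1 k f * f (S k)
  end.

Definition peval (c : nat -> R) (d : nat) (x : R) : R :=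
  sumlt (S d) (fun i => c i * x ^ i).

Definition is_derive_within (D : R -> Prop) (f : R -> R) (x l : R) : Prop :=
  filterlim (fun y => (f y - f x) / (y - x))
    (within (fun y => D y /\ y <> x) (locally x)) (locally l).

Definition smooth_on_I11 (f : R -> R) : Prop :=
  exists d : nat -> R -> R,
    (forall x, I11 x -> d O x = f x) /\
    (forall k x, I11 x -> is_derive_within I11 (d k) x (d (S k) x)).

Definition null_set (N : R -> Prop) : Prop :=
  forall eps, 0 < eps ->
    exists a b : nat -> R,
      (forall k, a k <= b k) /\
      (forall x, N x -> exists k, a k < x < b k) /\
      (forall K, sumlt K (fun k => b k - a k) <= eps).

Definition ae_I11 (P : R -> Prop) : Prop :=
  exists N, null_set N /\ forall x, I11 x -> ~ N x -> P x.

Definition orth_poly (W : R -> R) (n : nat) (c : nat -> R) : Prop :=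
  c n <> 0 /\
  forall (d : nat) (q : nat -> R), (d < n)%nat ->
    RInt (fun x => peval c n x * peval q d x * W x) (-1) 1 = 0.

Definition gauss_rule (W : R -> R) (n : nat) (x w : nat -> R) : Prop :=
  (exists c, orth_poly W n c /\
     (forall k, (k < n)%nat -> peval c n (x k) = 0)) /\
  (forall k l, (k < n)%nat -> (l < n)%nat -> x k = x l -> k = l) /\
  (forall (d : nat) (q : nat -> R), (d < 2 * n)%nat ->
     RInt (fun t => peval q d t * W t) (-1) 1
     = sumlt n (fun k => w k * peval q d (x k))).

Definition remainder (W : R -> R) (n : nat) (x w : nat -> R) (f : R -> R) : R :=
  RInt (fun t => f t * W t) (-1) 1 - sumlt n (fun k => w k * f (x k)).

Definition Cremainder (W : R -> R) (n : nat) (x w : nat -> R) (f : C -> C) : C :=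
  (@RInt C_R_CompleteNormedModule (fun t => RtoC (W t) * f (RtoC t))%C (-1) 1
   - Csumlt n (fun k => RtoC (w k) * f (RtoC (x k))))%C.

(* open region bounded by the ellipse with foci -1, 1 and semiaxis sum rho *)
Definition ellipse_interior (rho : R) (z : C) : Prop :=
  Cmod (z - RtoC 1)%C + Cmod (z + RtoC 1)%C < rho + / rho.

Definition analytic_on (D : C -> Prop) (f : C -> C) : Prop :=
  forall z, D z -> ex_derive (K := C_AbsRing) (V := C_NormedModule) f z.

Fixpoint disjoint_from (lo : R) (l : list (R * R)) : Prop :=
  match l with
  | nil => True
  | cons (a, b) l' => lo <= a /\ a <= b /\ disjoint_from b l'
  end.

Definition intervals_in_I11 (l : list (R * R)) : Prop :=
  disjoint_from (-1) l /\ List.Forall (fun ab => snd ab <= 1) l.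

Definition abs_continuous_I11 (F : R -> R) : Prop :=
  forall eps, 0 < eps -> exists delta, 0 < delta /\
    forall l, intervals_in_I11 l ->
      List.fold_right (fun ab s => (snd ab - fst ab) + s) 0 l < delta ->
      List.fold_right (fun ab s => Rabs (F (snd ab) - F (fst ab)) + s) 0 l < eps.

Definition is_partition_I11 (k : nat) (t : nat -> R) : Prop :=
  t O = -1 /\ t k = 1 /\ forall i, (i < k)%nat -> t i < t (S i).

Definition total_variation_I11 (h : R -> R) (V : R) : Prop :=
  is_lub (fun s => exists k t, is_partition_I11 k t /\
             s = sumlt k (fun i => Rabs (h (t (S i)) - h (t i)))) V.

(* Main.v *)
Require Import Defs.
From Stdlib Require Import Reals Lra Lia Arith Classical ClassicalEpsilon List.
From Coquelicot Require Import Coquelicot.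
Open Scope R_scope.

(* Exactness on degree [2n - 1] forces the nodes into [[-1,1]] and the weights to be nonnegative, so
   the remainder [R_n] kills the Chebyshev polynomials [T_k], [k < 2n], and is bounded by
   [2 K sup |f|] for every continuous [f].  Averaging [f o cos] against the de la Vallee-Poussin kernel
   gives polynomials converging uniformly to [f] whose Chebyshev coefficients are dominated by those
   [a_k] of [f]; hence [|R_n f| <= 2 K sum_(k >= 2n) |a_k|] and only coefficient bounds are needed.
   (i) Under the Joukowski map [a_k] is a mean of [f z * exp (- k (s + i t))] over a vertical segment,
   which by Goursat's theorem and periodicity does not depend on [s]; so [|a_k| <= 2 M / rho^k].
   (ii) Integration by parts gives [2 k a_k(F) = a_(k-1)(F') - a_(k+1)(F')].  At the last step [F' = h]
   has bounded variation: [F] is a uniform limit of piecewise linear functions whose slopes have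
   variation at most that of [h], i.e. of combinations of hinges [max 0 (x - c)], whose coefficients
   are explicit.  The resulting bounds telescope. *)

(** * Gaussian rules with nonnegative weight *)

(** The constant 4 in both bounds is 2 times 2. Integral and quadrature sum contribute one [K] each,
    since for [n >= 1] the nonnegative weights add up to [K]; the other 2 is the normalisation
    [2 / PI] of the Chebyshev coefficients, which turns [PI * M / rho ^ k] into [2 * M / rho ^ k].
    The kernel average is used instead of partial sums of the Chebyshev series because its
    multipliers lie in [0,1], so coefficient bounds pass to it unchanged, while it converges
    uniformly for every continuous [f]: no series has to be summed or identified with [f]. The
    obstacle in (ii) is that derivatives are given almost everywhere only. A covering argument turns
    absolute continuity into mean value inequalities, and these take the place of Lebesgue
    integration. Where the derivative is again absolutely continuous, they make it exist at every
    point; at the last step they compare difference quotients of [F] with values of [h] at chosen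
    points, so that [h] itself is never integrated. *)

Lemma sumlt_ext n f g : (forall i, (i < n)%nat -> f i = g i) -> sumlt n f = sumlt n g.
Proof.
  induction n as [|n IH]; intros H; simpl; [reflexivity|].
  rewrite IH, (H n) by (intros; auto with arith); reflexivity.
Qed.

Lemma sumlt_lin n a b f g :
  sumlt n (fun i => a * f i + b * g i) = a * sumlt n f + b * sumlt n g.
Proof. induction n as [|n IH]; simpl; [ring|rewrite IH; ring]. Qed.

Lemma sumlt_scal n a f : sumlt n (fun i => a * f i) = a * sumlt n f.
Proof. induction n as [|n IH]; simpl; [ring|rewrite IH; ring]. Qed.

Lemma sumlt_zero n f : (forall i, (i < n)%nat -> f i = 0) -> sumlt n f = 0.
Proof.
  induction n as [|n IH]; intros H; simpl; [reflexivity|].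
  rewrite IH, (H n) by (intros; auto with arith); ring.
Qed.

Lemma sumlt_le n f g : (forall i, (i < n)%nat -> f i <= g i) -> sumlt n f <= sumlt n g.
Proof.
  induction n as [|n IH]; intros H; simpl; [lra|].
  apply Rplus_le_compat; [apply IH; intros; auto with arith|auto with arith].
Qed.

Lemma sumlt_abs n f : Rabs (sumlt n f) <= sumlt n (fun i => Rabs (f i)).
Proof.
  induction n as [|n IH]; simpl; [rewrite Rabs_R0; lra|].
  eapply Rle_trans; [apply Rabs_triang|lra].
Qed.

Lemma sumlt_S_l n f : sumlt (S n) f = f O + sumlt n (fun i => f (S i)).
Proof.
  induction n as [|n IH]; [simpl; ring|].
  change (sumlt (S n) f + f (S n) = f O + (sumlt n (fun i => f (S i)) + f (S n))).
  rewrite IH; ring.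
Qed.

Lemma sumlt_app n k f : sumlt (n + k) f = sumlt n f + sumlt k (fun i => f (n + i)%nat).
Proof.
  induction k as [|k IH]; [rewrite Nat.add_0_r; simpl; ring|].
  rewrite Nat.add_succ_r; simpl; rewrite IH; ring.
Qed.

Lemma sumlt_single n k f :
  (k < n)%nat -> (forall i, (i < n)%nat -> i <> k -> f i = 0) -> sumlt n f = f k.
Proof.
  induction n as [|n IH]; intros Hk H; [lia|]; simpl.
  destruct (Nat.eq_dec k n) as [->|Hne].
  - rewrite sumlt_zero; [ring|]. intros i Hi; apply H; lia.
  - rewrite (H n) by lia. rewrite IH; [ring|lia|intros; apply H; lia].
Qed.

(** * Continuous functions on the line and their integrals *)

Lemma cont_continuous f : continuity f -> forall x, continuous f x.
Proof. intros H x; apply continuity_pt_filterlim, H. Qed.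

Lemma cont_of_continuous f : (forall x, continuous f x) -> continuity f.
Proof. intros H x; apply continuity_pt_filterlim, H. Qed.

Lemma cont_eps f : continuity f <->
  forall x eps, 0 < eps -> exists d, 0 < d /\ forall y, Rabs (y - x) < d -> Rabs (f y - f x) < eps.
Proof.
  split.
  - intros H x eps He. destruct (H x eps He) as (d & Hd & H1).
    exists d; split; [exact Hd|]. intros y Hy.
    destruct (Req_dec x y) as [->|Hne].
    + unfold Rminus; rewrite Rplus_opp_r, Rabs_R0; exact He.
    + apply H1; split; [split; [exact I|exact Hne]|exact Hy].
  - intros H x eps He. destruct (H x eps He) as (d & Hd & H1).
    exists d; split; [exact Hd|]. intros y [_ Hy]. apply H1, Hy.
Qed.

Lemma cont_const c : continuity (fun _ => c).
Proof. apply continuity_const; intros ? ?; reflexivity. Qed.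
Lemma cont_id : continuity (fun x => x).
Proof. intros x; apply continuity_pt_id. Qed.
Lemma cont_plus f g : continuity f -> continuity g -> continuity (fun x => f x + g x).
Proof. intros; apply (continuity_plus f g); assumption. Qed.
Lemma cont_minus f g : continuity f -> continuity g -> continuity (fun x => f x - g x).
Proof. intros; apply (continuity_minus f g); assumption. Qed.
Lemma cont_opp f : continuity f -> continuity (fun x => - f x).
Proof. intros; apply (continuity_opp f); assumption. Qed.
Lemma cont_mult f g : continuity f -> continuity g -> continuity (fun x => f x * g x).
Proof. intros; apply (continuity_mult f g); assumption. Qed.
Lemma cont_comp f u : continuity f -> continuity u -> continuity (fun x => f (u x)).
Proof. intros; apply (continuity_comp u f); assumption. Qed.
Lemma cont_pow f n : continuity f -> continuity (fun x => f x ^ n).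
Proof.
  intros H; induction n as [|n IH]; simpl; [apply cont_const|].
  apply (cont_mult f (fun x => f x ^ n)); assumption.
Qed.
Lemma cont_sum n (f : nat -> R -> R) :
  (forall i, continuity (f i)) -> continuity (fun x => sumlt n (fun i => f i x)).
Proof.
  intros H; induction n as [|n IH]; simpl; [apply cont_const|].
  apply (cont_plus (fun x => sumlt n (fun i => f i x)) (f n)); auto.
Qed.
Lemma cont_ext f g : (forall x, g x = f x) -> continuity f -> continuity g.
Proof.
  intros E H; apply cont_eps; intros x eps He.
  destruct (proj1 (cont_eps f) H x eps He) as (d & Hd & H1).
  exists d; split; [exact Hd|]; intros y Hy; rewrite !E; auto.
Qed.

Ltac ct :=
  repeat first
  [ assumption
  | match goal with
    | |- forall _, _ => intro
    | |- continuity (fun x => ?c) => apply (cont_const c)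
    | |- continuity (fun x => x) => apply cont_id
    | |- continuity (fun x => @?f x + @?g x) => apply (cont_plus f g)
    | |- continuity (fun x => @?f x - @?g x) => apply (cont_minus f g)
    | |- continuity (fun x => @?f x * @?g x) => apply (cont_mult f g)
    | |- continuity (fun x => @?f x / @?g x) => apply (cont_mult f (fun x => / g x))
    | |- continuity (fun x => - @?f x) => apply (cont_opp f)
    | |- continuity (fun x => @?f x ^ ?n) => apply (cont_pow f n)
    | |- continuity (fun x => sumlt ?n (@?f x)) => apply (cont_sum n (fun i x => f x i)); intro; cbv beta
    | |- continuity (fun x => sin (@?u x)) => apply (cont_comp sin u); [exact continuity_sin|]
    | |- continuity (fun x => cos (@?u x)) => apply (cont_comp cos u); [exact continuity_cos|]
    | |- continuity (fun x => Rabs (@?u x)) => apply (cont_comp Rabs u); [exact Rcontinuity_abs|]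
    | H : continuity ?f |- continuity (fun x => ?f (@?u x)) => apply (cont_comp f u); [exact H|]
    end ].

Lemma ex_int f a b : continuity f -> ex_RInt f a b.
Proof. intros H; apply (@ex_RInt_continuous R_CompleteNormedModule); intros; apply cont_continuous, H. Qed.

(* Equations between integrals may be typed in [CompleteNormedModule.sort _], which [ring] rejects. *)
Ltac rring := match goal with |- @eq _ ?a ?b => change (@eq R a b) end; ring.

Lemma int_correct f a b : continuity f -> is_RInt (V := R_NormedModule) f a b (RInt f a b).
Proof. intros H; apply (RInt_correct (V := R_CompleteNormedModule)), ex_int, H. Qed.

Lemma int_lin al be f g a b : continuity f -> continuity g ->
  RInt (fun x => al * f x + be * g x) a b = al * RInt f a b + be * RInt g a b.
Proof.
  intros Hf Hg. apply is_RInt_unique.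
  apply (is_RInt_plus (V := R_NormedModule) (fun x => al * f x) (fun x => be * g x)).
  - apply (is_RInt_scal (V := R_NormedModule) f a b al), int_correct, Hf.
  - apply (is_RInt_scal (V := R_NormedModule) g a b be), int_correct, Hg.
Qed.

Lemma int_ext (f g : R -> R) a b : a <= b -> (forall x, a <= x <= b -> f x = g x) -> RInt f a b = RInt g a b.
Proof.
  intros Hab H; apply RInt_ext; intros x; rewrite Rmin_left, Rmax_right by exact Hab.
  intros; apply H; lra.
Qed.

Lemma int_ext_all (f g : R -> R) a b : (forall x, f x = g x) -> RInt f a b = RInt g a b.
Proof. intros H; apply RInt_ext; intros; apply H. Qed.

Lemma int_plus f g a b : continuity f -> continuity g ->
  RInt (fun x => f x + g x) a b = RInt f a b + RInt g a b.
Proof.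
  intros Hf Hg. rewrite (int_ext_all _ (fun x => 1 * f x + 1 * g x)) by (intros; ring).
  rewrite int_lin by assumption; rring.
Qed.

Lemma int_scal c f a b : continuity f -> RInt (fun x => c * f x) a b = c * RInt f a b.
Proof.
  intros Hf. rewrite (int_ext_all _ (fun x => c * f x + 0 * f x)) by (intros; ring).
  rewrite int_lin by assumption; rring.
Qed.

Lemma int_const c a b : RInt (fun _ => c) a b = (b - a) * c.
Proof. exact (RInt_const (V := R_CompleteNormedModule) a b c). Qed.

Lemma int_sum n (f : nat -> R -> R) a b : (forall i, continuity (f i)) ->
  RInt (fun x => sumlt n (fun i => f i x)) a b = sumlt n (fun i => RInt (f i) a b).
Proof.
  intros H; induction n as [|n IH]; simpl; [rewrite int_const; ring|].
  rewrite (int_plus (fun x => sumlt n (fun i => f i x)) (f n)), IH; auto.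
  apply cont_sum, H.
Qed.

Lemma int_le f g a b : a <= b -> continuity f -> continuity g ->
  (forall x, a <= x <= b -> f x <= g x) -> RInt f a b <= RInt g a b.
Proof.
  intros Hab Hf Hg H; apply RInt_le; auto using ex_int. intros; apply H; lra.
Qed.

Lemma int_abs_le f g a b : a <= b -> continuity f -> continuity g ->
  (forall x, a <= x <= b -> Rabs (f x) <= g x) -> Rabs (RInt f a b) <= RInt g a b.
Proof.
  intros Hab Hf Hg H; apply Rabs_le; split.
  - replace (- RInt g a b) with ((-1) * RInt g a b) by ring.
    rewrite <- int_scal by exact Hg. apply int_le; auto; [ct|].
    intros x Hx; specialize (H x Hx); apply Rabs_le_between in H; lra.
  - apply int_le; auto. intros x Hx; specialize (H x Hx); apply Rabs_le_between in H; lra.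
Qed.

Lemma int_FTC F f a b : (forall x, is_derive F x (f x)) -> continuity f ->
  RInt f a b = F b - F a.
Proof.
  intros HF Hf; apply is_RInt_unique, (is_RInt_derive (V := R_CompleteNormedModule) F f); intros; auto.
  apply cont_continuous, Hf.
Qed.

Lemma int_eq0 f a b : a < b -> continuity f -> (forall x, a <= x <= b -> 0 <= f x) ->
  RInt f a b = 0 -> forall x, a <= x <= b -> f x = 0.
Proof.
  intros Hab Hf Hpos H0 x Hx.
  destruct (Req_dec (f x) 0) as [E|Hne]; [exact E|exfalso].
  assert (Hfx : 0 < f x) by (specialize (Hpos x Hx); lra).
  destruct (proj1 (cont_eps f) Hf x (f x) Hfx) as (d & Hd & H).
  set (l := Rmax a (x - d / 2)). set (r := Rmin b (x + d / 2)).
  assert (Hl : a <= l /\ x - d / 2 <= l /\ l <= x) by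
    (unfold l; split; [apply Rmax_l|split; [apply Rmax_r|apply Rmax_lub; lra]]).
  assert (Hr : r <= b /\ r <= x + d / 2 /\ x <= r) by
    (unfold r; split; [apply Rmin_l|split; [apply Rmin_r|apply Rmin_glb; lra]]).
  assert (Hlr : l < r).
  { unfold l, r; apply Rmax_lub_lt; apply Rmin_glb_lt; lra. }
  assert (P : 0 < RInt f l r).
  { apply RInt_gt_0; [exact Hlr| |intros; apply cont_continuous, Hf].
    intros y Hy. assert (Hy' : Rabs (y - x) < d) by (apply Rabs_def1; lra).
    specialize (H y Hy'). apply Rabs_def2 in H. lra. }
  assert (P1 : 0 <= RInt f a l) by (apply RInt_ge_0; [lra|apply ex_int, Hf|intros; apply Hpos; lra]).
  assert (P2 : 0 <= RInt f r b) by (apply RInt_ge_0; [lra|apply ex_int, Hf|intros; apply Hpos; lra]).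
  assert (C1 := RInt_Chasles (V := R_CompleteNormedModule) f a l r (ex_int _ _ _ Hf) (ex_int _ _ _ Hf)).
  assert (C2 := RInt_Chasles (V := R_CompleteNormedModule) f a r b (ex_int _ _ _ Hf) (ex_int _ _ _ Hf)).
  unfold plus in C1, C2; simpl in C1, C2. lra.
Qed.

Lemma int_Chasles f a b c : continuity f -> RInt f a b + RInt f b c = RInt f a c.
Proof.
  intros Hf. exact (RInt_Chasles (V := R_CompleteNormedModule) f a b c (ex_int _ _ _ Hf) (ex_int _ _ _ Hf)).
Qed.

(** * Polynomial functions, exactness, nodes and weights *)

Definition ispoly (d : nat) (p : R -> R) : Prop :=
  exists q, forall x, p x = peval q d x.

Lemma ispoly_const c : ispoly 0 (fun _ => c).
Proof. exists (fun _ => c); intros x; unfold peval; simpl; ring. Qed.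

Lemma ispoly_le d e p : (d <= e)%nat -> ispoly d p -> ispoly e p.
Proof.
  intros Hde [q Hq]. exists (fun i => if le_dec i d then q i else 0); intros x.
  rewrite Hq; unfold peval. replace (S e) with (S d + (e - d))%nat by lia.
  rewrite sumlt_app, (sumlt_zero (e - d)), Rplus_0_r.
  - apply sumlt_ext; intros i Hi; destruct (le_dec i d); [reflexivity|lia].
  - intros i _; destruct (le_dec (S d + i) d); [lia|ring].
Qed.

Lemma ispoly_lin d a b p r : ispoly d p -> ispoly d r -> ispoly d (fun x => a * p x + b * r x).
Proof.
  intros [q Hq] [s Hs]. exists (fun i => a * q i + b * s i); intros x.
  rewrite Hq, Hs; unfold peval. rewrite <- sumlt_lin. apply sumlt_ext; intros; ring.
Qed.

Lemma ispoly_mulX d p : ispoly d p -> ispoly (S d) (fun x => x * p x).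
Proof.
  intros [q Hq]. exists (fun i => match i with O => 0 | S j => q j end); intros x.
  rewrite Hq; unfold peval. rewrite (sumlt_S_l (S d)), <- sumlt_scal.
  rewrite Rmult_0_l, Rplus_0_l. apply sumlt_ext; intros; simpl; ring.
Qed.

Lemma ispoly_ext d p r : (forall x, r x = p x) -> ispoly d p -> ispoly d r.
Proof. intros E [q Hq]; exists q; intros x; rewrite E; apply Hq. Qed.

Lemma ispoly_mul_affine d a b p : ispoly d p -> ispoly (S d) (fun x => (a * x + b) * p x).
Proof.
  intros H. apply (ispoly_ext _ (fun x => a * (x * p x) + b * p x)); [intros; ring|].
  apply ispoly_lin; [apply ispoly_mulX, H|apply (ispoly_le d); [lia|exact H]].
Qed.

Lemma cont_peval q d : continuity (peval q d).
Proof. unfold peval; ct. Qed.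

Lemma cont_ispoly d p : ispoly d p -> continuity p.
Proof. intros [q Hq]; apply (cont_ext (peval q d) p Hq), cont_peval. Qed.

(** Exactness for polynomial functions rather than coefficient sequences, so that products such as
    [nodal_sq] can be tested without computing their coefficients. *)
Definition exact_rule (W : R -> R) (n : nat) (x w : nat -> R) : Prop :=
  forall d p, (d < 2 * n)%nat -> ispoly d p ->
    RInt (fun t => p t * W t) (-1) 1 = sumlt n (fun k => w k * p (x k)).

Lemma gauss_exact W n x w : gauss_rule W n x w -> exact_rule W n x w.
Proof.
  intros (_ & _ & H) d p Hd [q Hq].
  rewrite (int_ext_all _ (fun t => peval q d t * W t)) by (intros; rewrite Hq; reflexivity).
  rewrite H by exact Hd. apply sumlt_ext; intros; rewrite Hq; reflexivity.
Qed.

(** The product of (y - x_j)^2 over j < n with j = k left out. It has degree 2n - 2 and vanishes at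
    every node except x_k, so exactness on it isolates w_k, and one more affine factor is still
    within degree 2n - 1. *)
Fixpoint nodal_sq (x : nat -> R) (k n : nat) (y : R) : R :=
  match n with
  | O => 1
  | S j => (if Nat.eq_dec j k then 1 else (y - x j) * (y - x j)) * nodal_sq x k j y
  end.

(** For [k >= n] no factor is skipped; [nodal_sq_poly] reaches this case when the skipped index is
    the last one. *)
Lemma nodal_sq_full x k n : (n <= k)%nat -> ispoly (2 * n) (nodal_sq x k n).
Proof.
  induction n as [|n IH]; intros Hk.
  - simpl; apply ispoly_const.
  - replace (2 * S n)%nat with (S (S (2 * n))) by lia.
    apply (ispoly_ext _ (fun y => (1 * y + - x n) * ((1 * y + - x n) * nodal_sq x k n y))).
    + intros y; simpl; destruct (Nat.eq_dec n k); [lia|ring].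
    + apply ispoly_mul_affine, ispoly_mul_affine, IH; lia.
Qed.

Lemma nodal_sq_poly x k n : (k < n)%nat -> ispoly (2 * n - 2) (nodal_sq x k n).
Proof.
  induction n as [|n IH]; intros Hk; [lia|].
  destruct (Nat.eq_dec n k) as [E|Hne].
  - apply (ispoly_ext _ (nodal_sq x k n)).
    + intros y; simpl; destruct (Nat.eq_dec n k); [ring|lia].
    + replace (2 * S n - 2)%nat with (2 * n)%nat by lia. apply nodal_sq_full; lia.
  - replace (2 * S n - 2)%nat with (S (S (2 * n - 2))) by lia.
    apply (ispoly_ext _ (fun y => (1 * y + - x n) * ((1 * y + - x n) * nodal_sq x k n y))).
    + intros y; simpl; destruct (Nat.eq_dec n k); [lia|ring].
    + apply ispoly_mul_affine, ispoly_mul_affine, IH; lia.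
Qed.

Lemma nodal_sq_nonneg x k n y : 0 <= nodal_sq x k n y.
Proof.
  induction n as [|n IH]; simpl; [lra|]. destruct (Nat.eq_dec n k); [lra|].
  apply Rmult_le_pos; [apply Rle_0_sqr|exact IH].
Qed.

Lemma nodal_sq_pos x k n y :
  (forall j, (j < n)%nat -> j <> k -> y <> x j) -> 0 < nodal_sq x k n y.
Proof.
  induction n as [|n IH]; intros H; simpl; [lra|].
  apply Rmult_lt_0_compat.
  - destruct (Nat.eq_dec n k); [lra|]. apply Rsqr_pos_lt. intros E. apply (H n); [lia|assumption|lra].
  - apply IH; intros; apply H; lia.
Qed.

Lemma nodal_sq_zero x k n j : (j < n)%nat -> j <> k -> nodal_sq x k n (x j) = 0.
Proof.
  induction n as [|n IH]; intros Hj Hk; [lia|]; simpl.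
  destruct (Nat.eq_dec j n) as [->|Hne].
  - destruct (Nat.eq_dec n k); [lia|ring].
  - rewrite IH by lia; ring.
Qed.

Definition nonneg_weight (W : R -> R) : Prop :=
  continuity W /\ (forall t, I11 t -> 0 <= W t) /\ exists t, I11 t /\ W t <> 0.

(** The new factor vanishes only at [a]. If the point where [W] is known to be nonzero happens to be
    [a], continuity keeps [W] positive at a nearby point of [-1,1] different from [a]. Iterating
    this multiplies a weight by [nodal_sq] without making it vanish identically. *)
Lemma nonneg_weight_sq W a : nonneg_weight W -> nonneg_weight (fun t => ((t - a) * (t - a)) * W t).
Proof.
  intros (HC & HP & t0 & Ht0 & HW0). split; [ct|split].
  - intros t Ht; apply Rmult_le_pos; [apply Rle_0_sqr|auto].
  - destruct (Req_dec t0 a) as [E|Hne].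
    + assert (Hpos : 0 < W t0) by (specialize (HP t0 Ht0); lra).
      destruct (proj1 (cont_eps W) HC t0 (W t0) Hpos) as (d & Hd & H).
      assert (Hu : exists u, I11 u /\ u <> t0 /\ Rabs (u - t0) < d).
      (* A step of length at most 1 taken towards 0 from [t0], to the right when [t0 <= 0], cannot
         leave [-1,1]. *)
      { set (e := Rmin (d / 2) 1). assert (He : 0 < e <= d / 2 /\ e <= 1).
        { unfold e; split; [split; [apply Rmin_glb_lt; lra|apply Rmin_l]|apply Rmin_r]. }
        unfold I11 in *. destruct (Rle_dec t0 0).
        - exists (t0 + e); split; [lra|split; [lra|apply Rabs_def1; lra]].
        - exists (t0 - e); split; [lra|split; [lra|apply Rabs_def1; lra]]. }
      destruct Hu as (u & Hu & Hut & Hud). exists u; split; [exact Hu|].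
      specialize (H u Hud). apply Rabs_def2 in H.
      apply Rmult_integral_contrapositive; split; [|lra].
      apply Rmult_integral_contrapositive; split; lra.
    + exists t0; split; [exact Ht0|].
      apply Rmult_integral_contrapositive; split; [|exact HW0].
      apply Rmult_integral_contrapositive; split; lra.
Qed.

Lemma nonneg_weight_nodal W x k n : nonneg_weight W ->
  exists t, I11 t /\ nodal_sq x k n t * W t <> 0.
Proof.
  intros H. assert (G : nonneg_weight (fun t => nodal_sq x k n t * W t)); [|apply G].
  induction n as [|n IH]; simpl.
  - destruct H as (HC & HP & t & Ht & H0). split; [ct|split].
    + intros u Hu; rewrite Rmult_1_l; auto.
    + exists t; split; [exact Ht|]; rewrite Rmult_1_l; exact H0.
  - destruct (Nat.eq_dec n k).
    + destruct IH as (HC & HP & t & Ht & H0). split; [|split].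
      * apply (cont_ext (fun t => nodal_sq x k n t * W t)); [intros; ring|exact HC].
      * intros u Hu; rewrite Rmult_1_l; auto.
      * exists t; split; [exact Ht|]; rewrite Rmult_1_l; exact H0.
    + destruct (nonneg_weight_sq _ (x n) IH) as (HC & HP & t & Ht & H0). split; [|split].
      * apply (cont_ext _ _ (fun u => Rmult_assoc _ _ _) HC).
      * intros u Hu; rewrite Rmult_assoc; auto.
      * exists t; split; [exact Ht|]; rewrite Rmult_assoc; exact H0.
Qed.

Lemma gauss_nodes W n x w : nonneg_weight W -> exact_rule W n x w ->
  forall k, (k < n)%nat -> I11 (x k).
Proof.
  intros HW Hex k Hk. destruct (nonneg_weight_nodal W x k n HW) as (t & Ht & Hne).
  destruct HW as (HC & HP & _).
  assert (D : ispoly (2 * n - 2) (nodal_sq x k n)) by (apply nodal_sq_poly, Hk).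
  (* The polynomial [s (x - x_k) prod_(j <> k) (x - x_j)^2] vanishes at every node; if [x_k] lay
     outside [[-1,1]] it would have constant sign there, so its weighted integral could not be 0. *)
  assert (G : forall s, (forall y, I11 y -> 0 < s * (y - x k)) -> False).
  { intros s Hs.
    assert (Hp : ispoly (S (2 * n - 2)) (fun y => (s * y + - (s * x k)) * nodal_sq x k n y))
      by (apply ispoly_mul_affine, D).
    assert (HI : RInt (fun y => (s * y + - (s * x k)) * nodal_sq x k n y * W y) (-1) 1 = 0).
    { rewrite (Hex (S (2 * n - 2)) (fun y => (s * y + - (s * x k)) * nodal_sq x k n y)); [|lia|exact Hp].
      apply sumlt_zero; intros j Hj. destruct (Nat.eq_dec j k) as [->|Hjk]; [ring|].
      rewrite nodal_sq_zero by assumption; ring. }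
    assert (Cn := cont_ispoly _ _ D).
    assert (Z := int_eq0 (fun y => (s * y + - (s * x k)) * nodal_sq x k n y * W y) (-1) 1).
    specialize (Z ltac:(lra) ltac:(ct)).
    assert (Z1 := Z ltac:(intros y Hy; specialize (Hs y Hy); specialize (HP y Hy);
      pose proof (nodal_sq_nonneg x k n y); apply Rmult_le_pos; [apply Rmult_le_pos; lra|lra]) HI t Ht).
    simpl in Z1. apply Hne. rewrite Rmult_assoc in Z1. apply Rmult_integral in Z1.
    destruct Z1 as [Z1|Z1]; [specialize (Hs t Ht); lra|exact Z1]. }
  unfold I11; split; apply Rnot_lt_le; intros Hlt.
  - apply (G 1); unfold I11; intros; lra.
  - apply (G (-1)); unfold I11; intros; lra.
Qed.

(** Exactness on [nodal_sq x k n] leaves the single term w_k * [nodal_sq x k n (x k)], equal to a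
    nonnegative integral; its second factor is positive because the nodes are distinct. *)
Lemma gauss_weights W n x w : nonneg_weight W -> exact_rule W n x w ->
  (forall k l, (k < n)%nat -> (l < n)%nat -> x k = x l -> k = l) ->
  forall k, (k < n)%nat -> 0 <= w k.
Proof.
  intros (HC & HP & _) Hex Hinj k Hk.
  assert (D : ispoly (2 * n - 2) (nodal_sq x k n)) by (apply nodal_sq_poly, Hk).
  assert (HI := Hex (2 * n - 2)%nat _ ltac:(lia) D).
  rewrite (sumlt_single n k) in HI; [|exact Hk|].
  - assert (P : 0 < nodal_sq x k n (x k)).
    { apply nodal_sq_pos; intros j Hj Hjk E; apply Hjk; symmetry; apply Hinj; assumption. }
    assert (P1 : 0 <= RInt (fun t => nodal_sq x k n t * W t) (-1) 1).
    { assert (Cn := cont_ispoly _ _ D). apply RInt_ge_0; [lra|apply ex_int; ct|].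
      intros y Hy; apply Rmult_le_pos; [apply nodal_sq_nonneg|apply HP; unfold I11; lra]. }
    rewrite HI in P1. apply Rnot_lt_le; intros Hlt. nra.
  - intros j Hj Hjk; rewrite nodal_sq_zero by assumption; ring.
Qed.

(** Integral and quadrature sum are each at most [s * K] in absolute value. For the sum this follows
    from positivity of the weights and exactness on the constant [s]. *)
Lemma remainder_bound W n x w f s : nonneg_weight W -> gauss_rule W n x w -> continuity f ->
  (forall t, I11 t -> Rabs (f t) <= s) ->
  Rabs (remainder W n x w f) <= 2 * RInt W (-1) 1 * s.
Proof.
  intros HW HG Hf Hs. assert (Hex := gauss_exact _ _ _ _ HG).
  assert (Hx := gauss_nodes _ _ _ _ HW Hex).
  assert (Hw := gauss_weights _ _ _ _ HW Hex (proj1 (proj2 HG))).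
  destruct HW as (HC & HP & _).
  assert (Hs0 : 0 <= s) by (eapply Rle_trans; [apply Rabs_pos|apply (Hs 0); unfold I11; lra]).
  assert (HK : 0 <= RInt W (-1) 1) by (apply RInt_ge_0; [lra|apply ex_int, HC|intros; apply HP; unfold I11; lra]).
  assert (B1 : Rabs (RInt (fun t => f t * W t) (-1) 1) <= s * RInt W (-1) 1).
  { rewrite <- int_scal by exact HC. apply int_abs_le; [lra|ct|ct|].
    intros t Ht; rewrite Rabs_mult, (Rabs_right (W t)) by (apply Rle_ge, HP, Ht).
    apply Rmult_le_compat_r; [apply HP, Ht|apply Hs, Ht]. }
  assert (B2 : Rabs (sumlt n (fun k => w k * f (x k))) <= s * RInt W (-1) 1).
  (* For [n = 0] exactness does not reach constants, as no degree is below 0, but the sum is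
     empty. *)
  { destruct n as [|n]; [simpl; rewrite Rabs_R0; apply Rmult_le_pos; assumption|].
    assert (E := Hex 0%nat (fun _ => s) ltac:(lia) (ispoly_const s)). simpl in E.
    rewrite int_scal in E by exact HC. rewrite E.
    eapply Rle_trans; [apply sumlt_abs|]. apply (sumlt_le (S n)); intros k Hk.
    rewrite Rabs_mult, (Rabs_right (w k)) by (apply Rle_ge, Hw, Hk).
    apply Rmult_le_compat_l; [apply Hw, Hk|apply Hs, Hx, Hk]. }
  unfold remainder. eapply Rle_trans; [apply Rabs_triang|]. rewrite Rabs_Ropp. lra.
Qed.

Lemma remainder_lin W n x w a b f g : continuity W -> continuity f -> continuity g ->
  remainder W n x w (fun t => a * f t + b * g t) = a * remainder W n x w f + b * remainder W n x w g.
Proof.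
  intros HW Hf Hg; unfold remainder.
  rewrite (int_ext_all _ (fun t => a * (f t * W t) + b * (g t * W t))) by (intros; ring).
  rewrite int_lin by ct.
  rewrite (sumlt_ext n _ (fun k => a * (w k * f (x k)) + b * (w k * g (x k)))) by (intros; ring).
  rewrite sumlt_lin; ring.
Qed.

Lemma remainder_sum W n x w N c (f : nat -> R -> R) : continuity W -> (forall i, continuity (f i)) ->
  remainder W n x w (fun t => sumlt N (fun i => c i * f i t))
  = sumlt N (fun i => c i * remainder W n x w (f i)).
Proof.
  intros HW Hf; induction N as [|N IH]; simpl.
  - unfold remainder. rewrite sumlt_zero by (intros; ring).
    rewrite (int_ext_all _ (fun _ => 0)) by (intros; ring). rewrite int_const; ring.
  - rewrite <- IH.
    replace (remainder W n x w (fun t => sumlt N (fun i => c i * f i t)) + c N * remainder W n x w (f N))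
      with (1 * remainder W n x w (fun t => sumlt N (fun i => c i * f i t)) + c N * remainder W n x w (f N)) by ring.
    rewrite <- remainder_lin; [|exact HW|ct; apply Hf|apply Hf].
    unfold remainder; f_equal; [apply int_ext_all; intros; ring|].
    apply sumlt_ext; intros; ring.
Qed.

(** * Chebyshev coefficients and the de la Vallee-Poussin kernel *)

(* [vp N k] is the k-th complex Fourier coefficient of [((1 + cos u) / 2) ^ N],
   i.e. [binomial (2N) (N+k) / 4^N]. *)
Fixpoint vp (N k : nat) : R :=
  match N with
  | O => match k with O => 1 | S _ => 0 end
  | S N' => match k with
            | O => vp N' 0 / 2 + vp N' 1 / 2
            | S k' => vp N' (S k') / 2 + vp N' k' / 4 + vp N' (S (S k')) / 4
            end
  end.

Lemma vp_zero N k : (N < k)%nat -> vp N k = 0.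
Proof.
  revert k; induction N as [|N IH]; intros [|k] Hk; simpl; try lia; [reflexivity|].
  rewrite !IH by lia; lra.
Qed.

Lemma vp_nonneg N k : 0 <= vp N k.
Proof.
  revert k; induction N as [|N IH]; intros [|k]; simpl; try lra.
  - pose proof (IH 0%nat); pose proof (IH 1%nat); lra.
  - pose proof (IH k); pose proof (IH (S k)); pose proof (IH (S (S k))); lra.
Qed.

Lemma vp0_pos N : 0 < vp N 0.
Proof. induction N as [|N IH]; simpl; [lra|pose proof (vp_nonneg N 1); lra]. Qed.

(** The quotient of neighbouring binomial coefficients, cleared of denominators and proved from the
    recurrence. It gives monotonicity in [k] ([vp_le0]) and the rate of [vp0_succ]. *)
Lemma vp_ratio N k : (INR N + INR k + 1) * vp N (S k) = (INR N - INR k) * vp N k.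
Proof.
  revert k; induction N as [|N IH]; intros k.
  - destruct k; simpl; lra.
  - destruct k as [|k].
    + pose proof (IH 0%nat) as H0; pose proof (IH 1%nat) as H1.
      rewrite S_INR. simpl in *. lra.
    + pose proof (IH k) as H0; pose proof (IH (S k)) as H1; pose proof (IH (S (S k))) as H2.
      rewrite !S_INR in *. cbn [vp]. lra.
Qed.

Lemma vp_le0 N k : vp N k <= vp N 0.
Proof.
  induction k as [|k IH]; [lra|]. apply Rle_trans with (2 := IH).
  pose proof (vp_ratio N k) as H. pose proof (vp_nonneg N k). pose proof (pos_INR N). pose proof (pos_INR k).
  apply Rnot_lt_le; intros Hlt. nra.
Qed.

(** Passing from exponent N to N + 1 multiplies the kernel by (1 + cos u) / 2, so
    [vp N 0 - vp (S N) 0] is the mean of (1 - cos u) / 2 against the kernel. Hence 1 - cos u has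
    normalised mean 1 / (N + 1), which is the rate of concentration used in [vpsum_approx]. *)
Lemma vp0_succ N : 2 * (INR N + 1) * (vp N 0 - vp (S N) 0) = vp N 0.
Proof. pose proof (vp_ratio N 0) as H; simpl in *. lra. Qed.

Lemma cos_cos_succ k u : cos u * cos (INR (S k) * u) = (cos (INR (S (S k)) * u) + cos (INR k * u)) / 2.
Proof.
  rewrite !S_INR.
  replace ((INR k + 1 + 1) * u) with ((INR k + 1) * u + u) by ring.
  replace (INR k * u) with ((INR k + 1) * u - u) by ring.
  rewrite cos_plus, cos_minus; lra.
Qed.

Lemma vp_kernel N u :
  ((1 + cos u) / 2) ^ N = vp N 0 + 2 * sumlt N (fun i => vp N (S i) * cos (INR (S i) * u)).
Proof.
  induction N as [|N IH]; [simpl; ring|].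
  change (((1 + cos u) / 2) ^ S N) with ((1 + cos u) / 2 * ((1 + cos u) / 2) ^ N).
  rewrite IH.
  (* Multiplying [s1] by cos u gives half the sum of [sp] and [sm], the same coefficients on
     frequencies shifted up and down by one; regrouping by frequency reproduces the recurrence of
     [vp]. *)
  set (s1 := sumlt N (fun i => vp N (S i) * cos (INR (S i) * u))).
  set (sp := sumlt N (fun i => vp N (S i) * cos (INR (S (S i)) * u))).
  set (sm := sumlt N (fun i => vp N (S i) * cos (INR i * u))).
  assert (E1 : cos u * s1 = (sp + sm) / 2).
  { replace ((sp + sm) / 2) with (/ 2 * sp + / 2 * sm) by field.
    unfold s1, sp, sm; rewrite <- sumlt_lin, <- sumlt_scal. apply sumlt_ext; intros i _.
    rewrite <- Rmult_assoc, (Rmult_comm (cos u)), Rmult_assoc, cos_cos_succ. field. }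
  assert (E2 : sumlt (S N) (fun i => vp (S N) (S i) * cos (INR (S i) * u)) =
    / 2 * s1 + / 4 * (vp N 0 * cos u + sp) + / 4 * (sm - vp N 1)).
  { transitivity (/ 2 * sumlt (S N) (fun i => vp N (S i) * cos (INR (S i) * u)) +
      / 4 * (1 * sumlt (S N) (fun i => vp N i * cos (INR (S i) * u)) +
       1 * sumlt (S N) (fun i => vp N (S (S i)) * cos (INR (S i) * u)))).
    - rewrite <- sumlt_lin, <- !sumlt_scal, <- (Rmult_1_l (sumlt _ _)).
      rewrite <- (Rmult_1_l (sumlt _ (fun i => / 4 * _))), <- (Rmult_1_l (sumlt _ (fun i => / 2 * _))).
      rewrite <- sumlt_lin. rewrite Rmult_1_l. apply sumlt_ext; intros i _. cbn [vp]. field.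
    - rewrite (sumlt_S_l N (fun i => vp N i * _)).
      assert (E3 : sumlt (S N) (fun i => vp N (S (S i)) * cos (INR (S i) * u)) = sm - vp N 1).
      { assert (E4 : sumlt (S (S N)) (fun i => vp N (S i) * cos (INR i * u)) = sm).
        { cbn [sumlt]. rewrite !(vp_zero N) by lia. fold sm. ring. }
        rewrite <- E4, (sumlt_S_l (S N)). change (INR 0) with 0. rewrite Rmult_0_l, cos_0. ring. }
      rewrite E3. cbn [sumlt]. rewrite (vp_zero N (S N)) by lia. fold s1 sp.
      change (INR 1) with 1. rewrite (Rmult_1_l u). ring. }
  rewrite E2. cbn [vp]. nra.
Qed.

(** * Chebyshev polynomials and kernel averages *)

Fixpoint cheb (k : nat) (x : R) : R :=
  match k with
  | O => 1
  | S O => x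
  | S (S j as i) => 2 * x * cheb i x - cheb j x
  end.

Lemma cheb_rec k x : cheb (S (S k)) x = 2 * x * cheb (S k) x - cheb k x.
Proof. reflexivity. Qed.

Lemma pair_induction (P : nat -> Prop) :
  P O -> P 1%nat -> (forall k, P k -> P (S k) -> P (S (S k))) -> forall k, P k.
Proof.
  intros H0 H1 HS k. assert (P k /\ P (S k)) as [H _]; [|exact H].
  induction k as [|k [IH1 IH2]]; auto.
Qed.

Lemma cheb_cos k t : cheb k (cos t) = cos (INR k * t).
Proof.
  induction k as [| |k IH1 IH2] using pair_induction.
  - simpl; rewrite Rmult_0_l, cos_0; reflexivity.
  - simpl; rewrite Rmult_1_l; reflexivity.
  - rewrite cheb_rec, IH1, IH2, Rmult_assoc, cos_cos_succ. field.
Qed.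

Lemma cheb_poly k : ispoly k (cheb k).
Proof.
  induction k as [| |k IH1 IH2] using pair_induction.
  - apply ispoly_const.
  - apply (ispoly_ext 1 (fun x => x * 1)); [intros; simpl; ring|].
    apply ispoly_mulX, ispoly_const.
  - apply (ispoly_ext _ (fun x => 2 * (x * cheb (S k) x) + (-1) * cheb k x));
      [intros; rewrite cheb_rec; ring|].
    apply ispoly_lin; [apply ispoly_mulX, IH2|apply (ispoly_le k); [lia|exact IH1]].
Qed.

Lemma cont_cheb k : continuity (cheb k).
Proof. apply (cont_ispoly k), cheb_poly. Qed.

Lemma cheb_bound k x : I11 x -> Rabs (cheb k x) <= 1.
Proof.
  intros Hx; rewrite <- (cos_acos x) by exact Hx. rewrite cheb_cos.
  apply Rabs_le; pose proof (COS_bound (INR k * acos x)); lra.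
Qed.

(* Chebyshev coefficient, up to the factor [2 / PI] ([1 / PI] for [k = 0]). *)
Definition chebcoef (f : R -> R) (k : nat) : R :=
  RInt (fun t => f (cos t) * cos (INR k * t)) 0 PI.

Lemma sin_INR_PI k : sin (INR k * PI) = 0.
Proof. apply sin_eq_0_1; exists (Z.of_nat k); rewrite <- INR_IZR_INZ; reflexivity. Qed.

Lemma int_cos_0_PI k : RInt (fun t => cos (INR (S k) * t)) 0 PI = 0.
Proof.
  assert (Hk : INR (S k) <> 0) by (apply not_0_INR; lia).
  rewrite (int_FTC (fun t => sin (INR (S k) * t) / INR (S k))).
  - rewrite sin_INR_PI, Rmult_0_r, sin_0; rring.
  - intros t; revert Hk; generalize (INR (S k)); intros c Hk.
    auto_derive; [exact I|field; exact Hk].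
  - ct.
Qed.

(** The kernel folded onto [0, PI]: since f(cos t) is even in t, adding the value at s + t to that
    at s - t replaces integration over a full period. *)
Definition vpkernel (N : nat) (s t : R) : R :=
  ((1 + cos (s - t)) / 2) ^ N + ((1 + cos (s + t)) / 2) ^ N.

Lemma vpkernel_expand N s t : vpkernel N s t =
  2 * vp N 0 + sumlt N (fun i => 4 * vp N (S i) * cos (INR (S i) * s) * cos (INR (S i) * t)).
Proof.
  unfold vpkernel; rewrite !vp_kernel.
  rewrite (sumlt_ext N (fun i => 4 * vp N (S i) * cos (INR (S i) * s) * cos (INR (S i) * t))
    (fun i => 2 * (vp N (S i) * cos (INR (S i) * (s - t))) + 2 * (vp N (S i) * cos (INR (S i) * (s + t))))).
  - rewrite sumlt_lin; ring.
  - intros i _. rewrite Rmult_minus_distr_l, Rmult_plus_distr_l, cos_plus, cos_minus. ring.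
Qed.

Lemma cont_vpkernel N s : continuity (vpkernel N s).
Proof. unfold vpkernel; ct. Qed.

Lemma vpkernel_nonneg N s t : 0 <= vpkernel N s t.
Proof.
  unfold vpkernel; apply Rplus_le_le_0_compat; apply pow_le.
  - pose proof (COS_bound (s - t)); lra.
  - pose proof (COS_bound (s + t)); lra.
Qed.

Lemma int_vpkernel N s : RInt (vpkernel N s) 0 PI = PI * (2 * vp N 0).
Proof.
  rewrite (int_ext_all _ (fun t => 2 * vp N 0 +
    sumlt N (fun i => 4 * vp N (S i) * cos (INR (S i) * s) * cos (INR (S i) * t))))
    by (intros; apply vpkernel_expand).
  rewrite int_plus by ct. rewrite int_const, (int_sum N (fun i t => _)) by (intros; ct).
  rewrite sumlt_zero; [rring|]. intros i _. rewrite int_scal by ct. rewrite int_cos_0_PI; ring.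
Qed.

Definition vpcoef (f : R -> R) (N i : nat) : R :=
  match i with O => chebcoef f 0 / PI | S _ => 2 / PI * (vp N i / vp N 0) * chebcoef f i end.

Definition vpsum (f : R -> R) (N : nat) (x : R) : R :=
  sumlt (S N) (fun i => vpcoef f N i * cheb i x).

(** Two faces of one object: as a combination of Chebyshev polynomials, [vpsum] can be fed to the
    quadrature remainder; as an average against a nonnegative kernel of mass [PI * (2 * vp N 0)], it
    can be compared with [f]. *)
Lemma vpsum_cos f N s : continuity f ->
  PI * (2 * vp N 0) * vpsum f N (cos s) = RInt (fun t => f (cos t) * vpkernel N s t) 0 PI.
Proof.
  intros Hf. pose proof PI_RGT_0 as HPI. pose proof (vp0_pos N) as Hv.
  rewrite (int_ext_all _ (fun t => 2 * vp N 0 * (f (cos t) * cos (INR 0 * t)) +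
    sumlt N (fun i => 4 * vp N (S i) * cos (INR (S i) * s) * (f (cos t) * cos (INR (S i) * t))))).
  - rewrite int_plus by ct. rewrite int_scal by ct.
    rewrite (int_sum N (fun i t => _)) by (intros; ct).
    unfold vpsum; rewrite sumlt_S_l, Rmult_plus_distr_l, <- sumlt_scal.
    apply (f_equal2 Rplus).
    + unfold vpcoef; fold (chebcoef f 0). simpl cheb. field; lra.
    + apply sumlt_ext; intros i _. rewrite int_scal by ct. fold (chebcoef f (S i)).
      rewrite cheb_cos. unfold vpcoef. field; lra.
  - intros t. rewrite vpkernel_expand, Rmult_plus_distr_l, <- sumlt_scal.
    change (INR 0) with 0. rewrite Rmult_0_l, cos_0. apply (f_equal2 Rplus); [ring|].
    apply sumlt_ext; intros; ring.
Qed.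

Lemma cont_bounded f a b : a <= b -> continuity f ->
  exists M, 0 <= M /\ forall x, a <= x <= b -> Rabs (f x) <= M.
Proof.
  intros Hab Hf. destruct (continuity_ab_maj (fun x => Rabs (f x)) a b Hab) as (m & Hm & _).
  - intros c _. assert (C : continuity (fun x => Rabs (f x))) by ct. apply C.
  - exists (Rabs (f m)); split; [apply Rabs_pos|exact Hm].
Qed.

Lemma cont_uniform f a b eps : continuity f -> 0 < eps ->
  exists d, 0 < d /\ forall x y, a <= x <= b -> a <= y <= b -> Rabs (x - y) < d -> Rabs (f x - f y) < eps.
Proof.
  intros Hf He. destruct (Heine f (fun c => a <= c <= b) (compact_P3 a b) (fun x _ => Hf x) (mkposreal eps He)) as (d & Hd).
  exists d; split; [apply cond_pos|exact Hd].
Qed.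

(* Chord length: [(cos t - cos s)^2 <= 2 (1 - cos (s - t))]; so outside the range where uniform
   continuity applies, [1 - cos (s - t)] is bounded below. *)
Lemma modulus_cos f eps : continuity f -> 0 < eps ->
  exists C, 0 <= C /\ forall s t, Rabs (f (cos t) - f (cos s)) <= eps + C * (1 - cos (s - t)).
Proof.
  intros Hf He. destruct (cont_uniform f (-1) 1 eps Hf He) as (d & Hd & Hu).
  destruct (cont_bounded f (-1) 1 ltac:(lra) Hf) as (M & HM & HB).
  assert (Hdd : 0 < d * d) by (apply Rmult_lt_0_compat; exact Hd).
  assert (HC : 0 <= 4 * M / (d * d)) by (apply Rmult_le_pos; [lra|apply Rlt_le, Rinv_0_lt_compat, Hdd]).
  exists (4 * M / (d * d)); split; [exact HC|].
  intros s t. pose proof (COS_bound (s - t)) as Hc.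
  destruct (Rlt_dec (Rabs (cos t - cos s)) d) as [Hlt|Hge].
  - specialize (Hu _ _ (COS_bound t) (COS_bound s) Hlt).
    assert (0 <= 4 * M / (d * d) * (1 - cos (s - t))) by (apply Rmult_le_pos; lra). lra.
  - assert (B : Rabs (f (cos t) - f (cos s)) <= 2 * M).
    { eapply Rle_trans; [apply Rabs_triang|]. rewrite Rabs_Ropp.
      pose proof (HB _ (COS_bound t)); pose proof (HB _ (COS_bound s)); lra. }
    assert (D : d * d <= 2 * (1 - cos (s - t))).
    { assert (d * d <= Rabs (cos t - cos s) * Rabs (cos t - cos s)) by (apply Rmult_le_compat; lra).
      rewrite <- Rabs_mult, Rabs_right in H by (apply Rle_ge, Rle_0_sqr).
      rewrite cos_minus. pose proof (sin2_cos2 s) as P1; pose proof (sin2_cos2 t) as P2. unfold Rsqr in *.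
      pose proof (Rle_0_sqr (sin t - sin s)) as P3; unfold Rsqr in P3. lra. }
    apply Rle_trans with (4 * M / (d * d) * (d * d / 2)).
    + replace (4 * M / (d * d) * (d * d / 2)) with (2 * M) by (field; lra). exact B.
    + assert (4 * M / (d * d) * (d * d / 2) <= 4 * M / (d * d) * (1 - cos (s - t)))
        by (apply Rmult_le_compat_l; lra). lra.
Qed.

(** By [modulus_cos] the error at s is at most eps / 2 plus C times the normalised mean of 1 - cos.
    The latter is explicit: (1 - cos u) times the kernel of exponent N is twice the difference of
    the kernels of exponents N and N + 1, so by [vp0_succ] the error is at most eps / 2 + C / (N +
    1), uniformly in s. *)
Lemma vpsum_approx f eps : continuity f -> 0 < eps ->
  exists N, forall x, I11 x -> Rabs (vpsum f N x - f x) <= eps.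
Proof.
  intros Hf He. destruct (modulus_cos f (eps / 2) Hf ltac:(lra)) as (C & HC & Hmod).
  destruct (INR_unbounded (2 * C / eps)) as (N & HN).
  exists N; intros x Hx. rewrite <- (cos_acos x) by exact Hx. set (s := acos x).
  pose proof PI_RGT_0 as HPI. pose proof (vp0_pos N) as Hv.
  assert (HN1 : C / (INR N + 1) <= eps / 2).
  { pose proof (pos_INR N). apply Rmult_le_reg_r with (INR N + 1); [lra|].
    replace (C / (INR N + 1) * (INR N + 1)) with C by (field; lra).
    assert (E : 2 * C / eps * eps = 2 * C) by (field; lra).
    assert (2 * C / eps * eps <= INR N * eps) by (apply Rmult_le_compat_r; lra). lra. }
  assert (HD : vp N 0 - vp (S N) 0 = vp N 0 / (2 * (INR N + 1))).
  { pose proof (pos_INR N). apply Rmult_eq_reg_l with (2 * (INR N + 1)); [|lra].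
    rewrite vp0_succ. field. lra. }
  assert (Cn := cont_vpkernel N s). assert (Cn1 := cont_vpkernel (S N) s).
  assert (B : Rabs (RInt (fun t => (f (cos t) - f (cos s)) * vpkernel N s t) 0 PI) <=
     RInt (fun t => (eps / 2 + 2 * C) * vpkernel N s t + (- (2 * C)) * vpkernel (S N) s t) 0 PI).
  { apply int_abs_le; [lra|ct|ct|]. intros t _.
    rewrite Rabs_mult, (Rabs_right (vpkernel N s t)) by (apply Rle_ge, vpkernel_nonneg).
    (* The second summand of the kernel is the first one at -t, and cos(-t) = cos t, so the same
       modulus estimate serves both. *)
    unfold vpkernel. pose proof (Hmod s t) as M1. pose proof (Hmod s (- t)) as M2.
    rewrite cos_neg in M2. replace (s - - t) with (s + t) in M2 by ring.
    simpl pow.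
    assert (P1 : 0 <= ((1 + cos (s - t)) / 2) ^ N) by (apply pow_le; pose proof (COS_bound (s - t)); lra).
    assert (P2 : 0 <= ((1 + cos (s + t)) / 2) ^ N) by (apply pow_le; pose proof (COS_bound (s + t)); lra).
    apply (Rmult_le_compat_r _ _ _ P1) in M1. apply (Rmult_le_compat_r _ _ _ P2) in M2. lra. }
  rewrite int_lin in B by assumption. rewrite !int_vpkernel in B.
  rewrite (int_ext_all _ (fun t => 1 * (f (cos t) * vpkernel N s t) + (- f (cos s)) * vpkernel N s t)) in B
    by (intros; ring).
  rewrite int_lin in B by ct. rewrite <- vpsum_cos, int_vpkernel in B by exact Hf.
  replace (1 * (PI * (2 * vp N 0) * vpsum f N (cos s)) + - f (cos s) * (PI * (2 * vp N 0)))
    with ((PI * (2 * vp N 0)) * (vpsum f N (cos s) - f (cos s))) in B by ring.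
  assert (HP : 0 < PI * (2 * vp N 0)) by (apply Rmult_lt_0_compat; lra).
  rewrite Rabs_mult, (Rabs_right _ (Rle_ge _ _ (Rlt_le _ _ HP))) in B.
  apply Rmult_le_reg_l with (1 := HP). eapply Rle_trans; [exact B|].
  replace ((eps / 2 + 2 * C) * (PI * (2 * vp N 0)) + - (2 * C) * (PI * (2 * vp (S N) 0)))
    with (PI * (2 * vp N 0) * (eps / 2) + PI * (4 * C) * (vp N 0 - vp (S N) 0)) by ring.
  rewrite HD. pose proof (pos_INR N).
  replace (PI * (4 * C) * (vp N 0 / (2 * (INR N + 1)))) with (PI * (2 * vp N 0) * (C / (INR N + 1))) by (field; lra).
  rewrite <- Rmult_plus_distr_l. apply Rmult_le_compat_l; lra.
Qed.

Lemma vpcoef_bound f N i : Rabs (vpcoef f N i) <= 2 / PI * Rabs (chebcoef f i).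
Proof.
  pose proof PI_RGT_0 as HPI. pose proof (vp0_pos N) as Hv.
  assert (HI : 0 < / PI) by (apply Rinv_0_lt_compat, HPI).
  destruct i as [|i]; unfold vpcoef.
  - unfold Rdiv. rewrite Rabs_mult, (Rabs_right (/ PI)) by lra.
    pose proof (Rabs_pos (chebcoef f 0)). nra.
  - rewrite Rabs_mult. apply Rmult_le_compat_r; [apply Rabs_pos|].
    assert (R1 : 0 <= vp N (S i) / vp N 0 <= 1).
    { split.
      - apply Rmult_le_pos; [apply vp_nonneg|apply Rlt_le, Rinv_0_lt_compat, Hv].
      - apply Rmult_le_reg_r with (vp N 0); [exact Hv|].
        replace (vp N (S i) / vp N 0 * vp N 0) with (vp N (S i)) by (field; lra).
        pose proof (vp_le0 N (S i)); lra. }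
    assert (R2 : 0 < 2 / PI) by (apply Rmult_lt_0_compat; lra).
    rewrite Rabs_right; [nra|]. apply Rle_ge, Rmult_le_pos; lra.
Qed.

Lemma Rle_eps a b C : 0 <= C -> (forall eps, 0 < eps -> a <= b + C * eps) -> a <= b.
Proof.
  intros HC H. apply Rnot_lt_le; intros Hlt.
  specialize (H ((a - b) / (2 * (C + 1)))).
  assert (0 < (a - b) / (2 * (C + 1))) by (apply Rmult_lt_0_compat; [lra|apply Rinv_0_lt_compat; lra]).
  specialize (H H0).
  assert (E : (C + 1) * ((a - b) / (2 * (C + 1))) = (a - b) / 2) by (field; lra). nra.
Qed.

(** The common reduction for (i) and (ii). [b k] bounds the coefficient in the normalisation
    [2 / PI * chebcoef f k]; index 0, which occurs when [n = 0], has the smaller factor [1 / PI] and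
    is covered too. Only partial sums of [b] enter, because each [vpsum f N] has finitely many
    terms. *)
Lemma remainder_chebcoef W n x w f (b : nat -> R) B :
  nonneg_weight W -> gauss_rule W n x w -> continuity f ->
  (forall k, (2 * n <= k)%nat -> Rabs (chebcoef f k) <= PI / 2 * b k) ->
  (forall N, sumlt N (fun i => b (2 * n + i)%nat) <= B) ->
  Rabs (remainder W n x w f) <= 2 * RInt W (-1) 1 * B.
Proof.
  intros HW HG Hf Hb HB. set (K := RInt W (-1) 1).
  assert (HC := proj1 HW).
  assert (HK : 0 <= K).
  { apply RInt_ge_0; [lra|apply ex_int, HC|intros; apply (proj1 (proj2 HW)); unfold I11; lra]. }
  assert (HB0 : 0 <= B) by (apply (HB 0%nat)).
  assert (Hex := gauss_exact _ _ _ _ HG). pose proof PI_RGT_0 as HPI.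
  apply (Rle_eps _ _ (2 * K)); [lra|]. intros eps He.
  destruct (vpsum_approx f eps Hf He) as (N & HN).
  assert (Cs : continuity (vpsum f N)).
  { unfold vpsum. apply (cont_sum (S N) (fun i t => vpcoef f N i * cheb i t)). intros i.
    assert (Ci := cont_cheb i). ct. }
  replace (remainder W n x w f) with
    (1 * remainder W n x w (vpsum f N) + (-1) * remainder W n x w (fun t => vpsum f N t - f t)).
  2:{ rewrite <- remainder_lin; [|exact HC|exact Cs|ct]. unfold remainder.
      apply (f_equal2 Rminus); [apply int_ext_all; intros; ring|apply sumlt_ext; intros; ring]. }
  eapply Rle_trans; [apply Rabs_triang|].
  rewrite !Rabs_mult, (Rabs_right 1), (Rabs_left (-1)) by lra.
  assert (R2 : Rabs (remainder W n x w (fun t => vpsum f N t - f t)) <= 2 * K * eps)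
    by (apply remainder_bound; [exact HW|exact HG|ct|exact HN]).
  assert (R1 : Rabs (remainder W n x w (vpsum f N)) <= 2 * K * B); [|lra].
  unfold vpsum. rewrite (remainder_sum W n x w (S N) (vpcoef f N) cheb HC cont_cheb).
  assert (Z : forall i, (i < 2 * n)%nat -> remainder W n x w (cheb i) = 0).
  { intros i Hi. unfold remainder. rewrite (Hex i (cheb i) Hi (cheb_poly i)). rring. }
  destruct (le_lt_dec (S N) (2 * n)) as [Hle|Hlt].
  - rewrite sumlt_zero; [|intros i Hi; rewrite Z by lia; ring].
    rewrite Rabs_R0. apply Rmult_le_pos; lra.
  - replace (S N) with (2 * n + (S N - 2 * n))%nat by lia.
    rewrite sumlt_app, (sumlt_zero (2 * n)), Rplus_0_l; [|intros i Hi; rewrite Z by lia; ring].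
    eapply Rle_trans; [apply sumlt_abs|].
    apply Rle_trans with (2 * K * sumlt (S N - 2 * n) (fun i => b (2 * n + i)%nat)).
    + rewrite <- sumlt_scal. apply sumlt_le; intros i Hi. rewrite Rabs_mult, Rmult_comm.
      apply Rmult_le_compat; try apply Rabs_pos.
      * rewrite <- (Rmult_1_r (2 * K)). apply remainder_bound; [exact HW|exact HG|apply cont_cheb|].
        intros t Ht; apply cheb_bound, Ht.
      * eapply Rle_trans; [apply vpcoef_bound|]. specialize (Hb (2 * n + i)%nat ltac:(lia)).
        replace (b (2 * n + i)%nat) with (2 / PI * (PI / 2 * b (2 * n + i)%nat)) by (field; lra).
        apply Rmult_le_compat_l; [|exact Hb]. apply Rlt_le, Rmult_lt_0_compat; [lra|apply Rinv_0_lt_compat, HPI].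
    + apply Rmult_le_compat_l; [lra|apply HB].
Qed.

(** * Goursat's theorem *)

Definition Cdiff (f : C -> C) (z l : C) : Prop :=
  forall eps, 0 < eps -> exists d, 0 < d /\
    forall y, Cmod (y - z)%C < d -> Cmod (f y - f z - (y - z) * l)%C <= eps * Cmod (y - z)%C.

Lemma ex_derive_Cdiff f z :
  ex_derive (K := C_AbsRing) (V := C_NormedModule) f z -> exists l, Cdiff f z l.
Proof.
  intros [l [_ H]]. exists l. intros eps He.
  destruct (H z (fun P HP => HP) (mkposreal eps He)) as [d Hd].
  exists d; split; [apply cond_pos|]. intros y Hy. exact (Hd y Hy).
Qed.

Lemma Cdiff_scal c f z l : Cdiff f z l -> Cdiff (fun y => c * f y)%C z (c * l)%C.
Proof.
  intros H eps He. assert (Hc := Cmod_ge_0 c).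
  assert (He' : 0 < eps / (Cmod c + 1)) by (apply Rmult_lt_0_compat; [lra|apply Rinv_0_lt_compat; lra]).
  destruct (H _ He') as (d & Hd & H1). exists d; split; [exact Hd|]. intros y Hy.
  replace (c * f y - c * f z - (y - z) * (c * l))%C with (c * (f y - f z - (y - z) * l))%C by ring.
  rewrite Cmod_mult. specialize (H1 y Hy). pose proof (Cmod_ge_0 (y - z)) as Hz.
  apply Rle_trans with (Cmod c * (eps / (Cmod c + 1) * Cmod (y - z))).
  - apply Rmult_le_compat_l; assumption.
  - rewrite <- Rmult_assoc. apply Rmult_le_compat_r; [exact Hz|].
    assert (E : (Cmod c + 1) * (eps / (Cmod c + 1)) = eps) by (field; lra). lra.
Qed.

Lemma im_le_Cmod z : Rabs (Im z) <= Cmod z.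
Proof. eapply Rle_trans; [apply Rmax_r|apply (Rmax_Cmod z)]. Qed.

(** The Cauchy-Riemann equations: multiplication by l = p + i q acts on the plane by the matrix with
    rows (p, -q) and (q, p). *)
Lemma Cdiff_real f x y l : Cdiff f (x, y) l ->
  differentiable_pt_lim (fun a b => Re (f (a, b))) x y (Re l) (- Im l) /\
  differentiable_pt_lim (fun a b => Im (f (a, b))) x y (Im l) (Re l).
Proof.
  intros H.
  assert (G : forall eps : posreal, locally_2d (fun a b =>
    Cmod (f (a, b) - f (x, y) - ((a, b) - (x, y)) * l)%C <= eps * Rmax (Rabs (a - x)) (Rabs (b - y))) x y).
  { intros eps. assert (He : 0 < eps / 2) by (apply is_pos_div_2).
    destruct (H _ He) as (d & Hd & H1). assert (Hd2 : 0 < d / 2) by lra.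
    exists (mkposreal _ Hd2). simpl. intros a b Ha Hb.
    (* The modulus is at most sqrt 2 times the maximum norm; rounding sqrt 2 up to 2 explains
       [eps / 2] and [d / 2]. *)
    assert (B : Cmod ((a, b) - (x, y))%C <= 2 * Rmax (Rabs (a - x)) (Rabs (b - y))).
    { eapply Rle_trans; [apply (Cmod_2Rmax ((a, b) - (x, y))%C)|]. simpl.
      apply Rmult_le_compat_r; [eapply Rle_trans; [apply Rabs_pos|apply Rmax_l]|].
      apply Rsqr_incr_0_var; [rewrite Rsqr_sqrt by lra; unfold Rsqr; lra|lra]. }
    eapply Rle_trans; [apply H1|].
    - eapply Rle_lt_trans; [exact B|]. assert (Rmax (Rabs (a - x)) (Rabs (b - y)) < d / 2) by (apply Rmax_lub_lt; assumption).
      lra.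
    - apply Rmult_le_compat_l with (r := eps / 2) in B; [lra|lra]. }
  split; intros eps; destruct (G eps) as (d & Hd); exists d; intros a b Ha Hb;
    (eapply Rle_trans; [|exact (Hd a b Ha Hb)]).
  - eapply Rle_trans; [|apply re_le_Cmod]. right; f_equal. simpl. unfold Re, Im; simpl. ring.
  - eapply Rle_trans; [|apply im_le_Cmod]. right; f_equal. simpl. unfold Re, Im; simpl. ring.
Qed.

(** The product rule as a composition with [Rmult], whose deviation from its linear part is exactly
    the product of the two increments. *)
Lemma diff2_mult f g x y fx fy gx gy :
  differentiable_pt_lim f x y fx fy -> differentiable_pt_lim g x y gx gy ->
  differentiable_pt_lim (fun a b => f a b * g a b) x y
    (g x y * fx + f x y * gx) (g x y * fy + f x y * gy).
Proof.
  intros Hf Hg. apply (differentiable_pt_lim_comp Rmult f g); [|exact Hf|exact Hg].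
  intros eps. exists eps; intros u v Hu Hv.
  replace (u * v - f x y * g x y - (g x y * (u - f x y) + f x y * (v - g x y)))
    with ((u - f x y) * (v - g x y)) by ring.
  rewrite Rabs_mult. apply Rmult_le_compat; try apply Rabs_pos; [lra|apply Rmax_r].
Qed.

Lemma diff2_lin c d f g x y fx fy gx gy :
  differentiable_pt_lim f x y fx fy -> differentiable_pt_lim g x y gx gy ->
  differentiable_pt_lim (fun a b => c * f a b + d * g a b) x y (c * fx + d * gx) (c * fy + d * gy).
Proof.
  intros Hf Hg. apply (differentiable_pt_lim_comp (fun u v => c * u + d * v) f g); [|exact Hf|exact Hg].
  intros eps. exists eps; intros u v Hu Hv.
  replace (c * u + d * v - (c * f x y + d * g x y) - (c * (u - f x y) + d * (v - g x y))) with 0 by ring.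
  rewrite Rabs_R0. apply Rmult_le_pos; [apply Rlt_le, cond_pos|].
  eapply Rle_trans; [apply Rabs_pos|apply Rmax_l].
Qed.

Lemma diff2_fst g x y l : is_derive g x l -> differentiable_pt_lim (fun a _ => g a) x y l 0.
Proof. intros H; apply differentiable_pt_lim_proj1_0, is_derive_Reals, H. Qed.

Lemma diff2_snd g x y l : is_derive g y l -> differentiable_pt_lim (fun _ b => g b) x y 0 l.
Proof.
  intros H eps. destruct (diff2_fst g y x l H eps) as (d & Hd). exists d; intros u v Hu Hv.
  specialize (Hd v u Hv Hu). rewrite Rmax_comm.
  replace (g v - g y - (0 * (u - x) + l * (v - y))) with (g v - g y - (l * (v - y) + 0 * (u - x))) by ring.
  exact Hd.
Qed.

Lemma diff2_cont_fst f x y fx fy :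
  differentiable_pt_lim f x y fx fy -> continuous (fun a => f a y) x.
Proof.
  intros H. apply (ex_derive_continuous (V := R_NormedModule) (fun a => f a y)).
  exists (fx * 1 + fy * 0). apply is_derive_Reals.
  apply (derivable_pt_lim_comp_2d f (fun a => a) (fun _ => y)); [exact H|apply derivable_pt_lim_id|apply derivable_pt_lim_const].
Qed.

Lemma diff2_cont_snd f x y fx fy :
  differentiable_pt_lim f x y fx fy -> continuous (fun b => f x b) y.
Proof.
  intros H. apply (ex_derive_continuous (V := R_NormedModule) (fun b => f x b)).
  exists (fx * 0 + fy * 1). apply is_derive_Reals.
  apply (derivable_pt_lim_comp_2d f (fun _ => x) (fun b => b)); [exact H|apply derivable_pt_lim_const|apply derivable_pt_lim_id].
Qed.

(* Circulation of [u dy + v dx] along the boundary of [[s, s + a] x [t, t + b]]. *)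
Definition circ (u v : R -> R -> R) (s t a b : R) : R :=
  RInt (fun y => u (s + a) y) t (t + b) - RInt (fun y => u s y) t (t + b)
  - (RInt (fun x => v x (t + b)) s (s + a) - RInt (fun x => v x t) s (s + a)).

(* The partial derivatives are not assumed continuous. *)
Definition closed_form (u v : R -> R -> R) (s0 s1 t0 t1 : R) : Prop :=
  forall x y, s0 <= x <= s1 -> t0 <= y <= t1 ->
    exists p q r, differentiable_pt_lim u x y p q /\ differentiable_pt_lim v x y r p.

Lemma closed_form_ex_u u v s0 s1 t0 t1 x a b : closed_form u v s0 s1 t0 t1 ->
  s0 <= x <= s1 -> t0 <= a -> a <= b -> b <= t1 -> ex_RInt (fun y => u x y) a b.
Proof.
  intros H Hx Ha Hab Hb. apply (ex_RInt_continuous (V := R_CompleteNormedModule)).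
  rewrite Rmin_left, Rmax_right by exact Hab. intros y Hy.
  destruct (H x y Hx ltac:(lra)) as (p & q & r & Hu & _). exact (diff2_cont_snd u x y p q Hu).
Qed.

Lemma closed_form_ex_v u v s0 s1 t0 t1 y a b : closed_form u v s0 s1 t0 t1 ->
  t0 <= y <= t1 -> s0 <= a -> a <= b -> b <= s1 -> ex_RInt (fun x => v x y) a b.
Proof.
  intros H Hy Ha Hab Hb. apply (ex_RInt_continuous (V := R_CompleteNormedModule)).
  rewrite Rmin_left, Rmax_right by exact Hab. intros x Hx.
  destruct (H x y ltac:(lra) Hy) as (p & q & r & _ & Hv). exact (diff2_cont_fst v x y r p Hv).
Qed.

Lemma RInt_split (f : R -> R) a b c : ex_RInt f a b -> ex_RInt f b c ->
  RInt f a c = RInt f a b + RInt f b c.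
Proof. intros H1 H2; symmetry; exact (RInt_Chasles (V := R_CompleteNormedModule) f a b c H1 H2). Qed.

(** Each inner edge of the four quarter rectangles is traversed twice in opposite directions and
    cancels; every outer edge is cut at its midpoint. *)
Lemma circ_split u v s0 s1 t0 t1 s t a b : closed_form u v s0 s1 t0 t1 ->
  0 <= a -> 0 <= b -> s0 <= s -> s + a <= s1 -> t0 <= t -> t + b <= t1 ->
  circ u v s t a b =
    circ u v s t (a / 2) (b / 2) + circ u v (s + a / 2) t (a / 2) (b / 2) +
    circ u v s (t + b / 2) (a / 2) (b / 2) + circ u v (s + a / 2) (t + b / 2) (a / 2) (b / 2).
Proof.
  intros H Ha Hb Hs Hsa Ht Htb. unfold circ.
  replace (s + a / 2 + a / 2) with (s + a) by field.
  replace (t + b / 2 + b / 2) with (t + b) by field.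
  assert (EU : forall x, s0 <= x <= s1 -> RInt (fun y => u x y) t (t + b) =
     RInt (fun y => u x y) t (t + b / 2) + RInt (fun y => u x y) (t + b / 2) (t + b)).
  { intros x Hx; apply RInt_split; eapply closed_form_ex_u; eauto; lra. }
  assert (EV : forall y, t0 <= y <= t1 -> RInt (fun x => v x y) s (s + a) =
     RInt (fun x => v x y) s (s + a / 2) + RInt (fun x => v x y) (s + a / 2) (s + a)).
  { intros y Hy; apply RInt_split; eapply closed_form_ex_v; eauto; lra. }
  rewrite !EU, !EV by lra. rring.
Qed.

Lemma int_diff_approx (f g : R -> R) a b c e : a <= b -> ex_RInt f a b -> ex_RInt g a b ->
  (forall x, a <= x <= b -> Rabs (f x - g x - c) <= e) ->
  Rabs (RInt f a b - RInt g a b - (b - a) * c) <= (b - a) * e.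
Proof.
  intros Hab Hf Hg H.
  assert (E : is_RInt (V := R_NormedModule) (fun x => f x - g x - c) a b (RInt f a b - RInt g a b - (b - a) * c)).
  { apply (is_RInt_minus (V := R_NormedModule) (fun x => f x - g x) (fun _ => c)).
    - apply (is_RInt_minus (V := R_NormedModule) f g); apply (RInt_correct (V := R_CompleteNormedModule)); assumption.
    - apply (is_RInt_const (V := R_NormedModule) a b c). }
  rewrite <- (is_RInt_unique (V := R_CompleteNormedModule) _ _ _ _ E).
  apply abs_RInt_le_const; [exact Hab|eexists; exact E|exact H].
Qed.

(** Near (x0, y0) both functions are affine up to a small multiple of the distance. The affine parts
    contribute p * a * b through [u] and the same through [v], and these cancel because the two
    forms share the partial derivative p. The errors on the two pairs of opposite edges are at most
    eps * (a + b) times b and a respectively. *)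
Lemma circ_local u v s0 s1 t0 t1 x0 y0 eps : closed_form u v s0 s1 t0 t1 ->
  s0 <= x0 <= s1 -> t0 <= y0 <= t1 -> 0 < eps ->
  exists d, 0 < d /\ forall s t a b, 0 <= a < d -> 0 <= b < d ->
    s0 <= s -> s + a <= s1 -> t0 <= t -> t + b <= t1 ->
    s <= x0 <= s + a -> t <= y0 <= t + b -> Rabs (circ u v s t a b) <= eps * (a + b) ^ 2.
Proof.
  intros H Hx0 Hy0 He. destruct (H x0 y0 Hx0 Hy0) as (p & q & r & Hu & Hv).
  assert (He2 : 0 < eps / 2) by lra.
  destruct (Hu (mkposreal _ He2)) as [d1 H1]. destruct (Hv (mkposreal _ He2)) as [d2 H2]. simpl in H1, H2.
  exists (Rmin d1 d2). split; [apply Rmin_glb_lt; apply cond_pos|].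
  intros s t a b Ha Hb Hs Hsa Ht Htb Hx Hy.
  assert (Hd1 := Rmin_l d1 d2). assert (Hd2 := Rmin_r d1 d2).
  assert (M : forall x y, s <= x <= s + a -> t <= y <= t + b ->
    Rabs (x - x0) <= a /\ Rabs (y - y0) <= b /\ Rmax (Rabs (x - x0)) (Rabs (y - y0)) <= a + b).
  { intros x y Hx' Hy'. assert (Rabs (x - x0) <= a) by (apply Rabs_le; lra).
    assert (Rabs (y - y0) <= b) by (apply Rabs_le; lra).
    repeat split; try assumption. apply Rmax_lub; lra. }
  assert (BU : Rabs (RInt (fun y => u (s + a) y) t (t + b) - RInt (fun y => u s y) t (t + b)
      - (t + b - t) * (p * a)) <= (t + b - t) * (eps * (a + b))).
  { apply int_diff_approx; [lra|eapply closed_form_ex_u; eauto; lra|eapply closed_form_ex_u; eauto; lra|].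
    intros y Hy'. destruct (M (s + a) y ltac:(lra) Hy') as (A1 & A2 & A3).
    destruct (M s y ltac:(lra) Hy') as (A4 & _ & A5).
    assert (G1 := H1 (s + a) y ltac:(lra) ltac:(lra)). assert (G2 := H1 s y ltac:(lra) ltac:(lra)).
    apply (Rmult_le_compat_l (eps / 2)) in A3; [|lra]. apply (Rmult_le_compat_l (eps / 2)) in A5; [|lra].
    replace (u (s + a) y - u s y - p * a) with
      ((u (s + a) y - u x0 y0 - (p * (s + a - x0) + q * (y - y0))) - (u s y - u x0 y0 - (p * (s - x0) + q * (y - y0)))) by ring.
    eapply Rle_trans; [apply Rabs_triang|]. rewrite Rabs_Ropp. lra. }
  assert (BV : Rabs (RInt (fun x => v x (t + b)) s (s + a) - RInt (fun x => v x t) s (s + a)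
      - (s + a - s) * (p * b)) <= (s + a - s) * (eps * (a + b))).
  { apply int_diff_approx; [lra|eapply closed_form_ex_v; eauto; lra|eapply closed_form_ex_v; eauto; lra|].
    intros x Hx'. destruct (M x (t + b) Hx' ltac:(lra)) as (A1 & A2 & A3).
    destruct (M x t Hx' ltac:(lra)) as (_ & A4 & A5).
    assert (G1 := H2 x (t + b) ltac:(lra) ltac:(lra)). assert (G2 := H2 x t ltac:(lra) ltac:(lra)).
    apply (Rmult_le_compat_l (eps / 2)) in A3; [|lra]. apply (Rmult_le_compat_l (eps / 2)) in A5; [|lra].
    replace (v x (t + b) - v x t - p * b) with
      ((v x (t + b) - v x0 y0 - (r * (x - x0) + p * (t + b - y0))) - (v x t - v x0 y0 - (r * (x - x0) + p * (t - y0)))) by ring.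
    eapply Rle_trans; [apply Rabs_triang|]. rewrite Rabs_Ropp. lra. }
  unfold circ.
  match type of BU with Rabs (?X - _) <= _ => match type of BV with Rabs (?Y - _) <= _ =>
    replace (X - Y) with ((X - (t + b - t) * (p * a)) - (Y - (s + a - s) * (p * b))) by rring end end.
  eapply Rle_trans; [apply Rabs_triang|]. rewrite Rabs_Ropp. simpl. lra.
Qed.

Lemma Rabs_triang4 a b c d : Rabs (a + b + c + d) <= Rabs a + Rabs b + Rabs c + Rabs d.
Proof.
  eapply Rle_trans; [apply Rabs_triang|apply Rplus_le_compat_r].
  eapply Rle_trans; [apply Rabs_triang|apply Rplus_le_compat_r, Rabs_triang].
Qed.

Lemma nested_intervals (s : nat -> R) (a : R) : 0 <= a ->
  (forall n, s n <= s (S n) /\ s (S n) + a * (/ 2) ^ S n <= s n + a * (/ 2) ^ n) ->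
  exists x, forall n, s n <= x <= s n + a * (/ 2) ^ n.
Proof.
  intros Ha H.
  assert (P : forall n, 0 <= a * (/ 2) ^ n) by (intros n; apply Rmult_le_pos; [exact Ha|apply pow_le; lra]).
  assert (M : forall k n, s n <= s (k + n)%nat /\ s (k + n)%nat + a * (/ 2) ^ (k + n) <= s n + a * (/ 2) ^ n).
  { induction k as [|k IH]; intros n; [simpl; lra|].
    destruct (IH n) as [I1 I2]. destruct (H (k + n)%nat) as [J1 J2].
    change (S k + n)%nat with (S (k + n)). lra. }
  assert (B : forall n m, s m <= s n + a * (/ 2) ^ n).
  { intros n m. destruct (le_lt_dec n m) as [L|L].
    - destruct (M (m - n)%nat n) as [_ I2]. replace (m - n + n)%nat with m in I2 by lia. specialize (P m); lra.
    - destruct (M (n - m)%nat m) as [I1 _]. replace (n - m + m)%nat with n in I1 by lia. specialize (P n); lra. }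
  destruct (completeness (fun x => exists n, x = s n)) as (x & Hub & Hlub).
  - exists (s 0%nat + a * (/ 2) ^ 0); intros y [m ->]; apply B.
  - exists (s 0%nat), 0%nat; reflexivity.
  - exists x; intros n; split; [apply Hub; exists n; reflexivity|].
    apply Hlub; intros y [m ->]; apply B.
Qed.

(** Bisection. If the circulation exceeded eps * (a + b)^2, one of the four quarters would exceed
    the same bound for its halved sides, since (a + b)^2 is divided by 4. The resulting nested
    rectangles close in on a point, where [circ_local] gives the opposite inequality. As eps is
    arbitrary, the circulation is 0. *)
Lemma goursat u v s0 t0 a b : 0 <= a -> 0 <= b ->
  closed_form u v s0 (s0 + a) t0 (t0 + b) -> circ u v s0 t0 a b = 0.
Proof.
  intros Ha Hb H.
  assert (G : forall eps, 0 < eps -> Rabs (circ u v s0 t0 a b) <= eps * (a + b) ^ 2).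
  { intros eps He. apply Rnot_lt_le; intros Hbad.
    set (h := fun n => (/ 2) ^ n).
    set (Bad := fun n (z : R * R) => s0 <= fst z /\ fst z + a * h n <= s0 + a /\
       t0 <= snd z /\ snd z + b * h n <= t0 + b /\
       eps * (a * h n + b * h n) ^ 2 < Rabs (circ u v (fst z) (snd z) (a * h n) (b * h n))).
    set (Nested := fun n (z z' : R * R) =>
       fst z <= fst z' /\ fst z' + a * h (S n) <= fst z + a * h n /\
       snd z <= snd z' /\ snd z' + b * h (S n) <= snd z + b * h n).
    assert (Hh : forall n, 0 < h n) by (intros n; apply pow_lt; lra).
    (* The premise [Bad n z] stands under the existential, so that choice yields a total function
       [next] on rectangles. *)
    assert (step : forall n z, exists z', Bad n z -> Bad (S n) z' /\ Nested n z z').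
    { intros n z. apply NNPP; intros Hno.
      assert (Hz : Bad n z) by (apply NNPP; intros Hz; apply Hno; exists z; intros Hz'; contradiction).
      destruct z as [s t]; destruct Hz as (Z1 & Z2 & Z3 & Z4 & Z5); simpl fst in *; simpl snd in *.
      specialize (Hh n). assert (Ha' : 0 <= a * h n) by (apply Rmult_le_pos; lra).
      assert (Hb' : 0 <= b * h n) by (apply Rmult_le_pos; lra).
      assert (EA : a * h (S n) = a * h n / 2) by (unfold h; simpl; field).
      assert (EB : b * h (S n) = b * h n / 2) by (unfold h; simpl; field).
      assert (Q : forall s' t', (s' = s \/ s' = s + a * h n / 2) -> (t' = t \/ t' = t + b * h n / 2) ->
        Rabs (circ u v s' t' (a * h n / 2) (b * h n / 2)) <= eps * (a * h n / 2 + b * h n / 2) ^ 2).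
      { intros s' t' Hs' Ht'. apply Rnot_lt_le; intros Hlt. apply Hno; exists (s', t'); intros _.
        unfold Bad, Nested; simpl fst; simpl snd. rewrite EA, EB. repeat split; lra. }
      rewrite (circ_split u v s0 (s0 + a) t0 (t0 + b)) in Z5 by assumption.
      pose proof (Q s t ltac:(lra) ltac:(lra)) as Q1. pose proof (Q (s + a * h n / 2) t ltac:(lra) ltac:(lra)) as Q2.
      pose proof (Q s (t + b * h n / 2) ltac:(lra) ltac:(lra)) as Q3.
      pose proof (Q (s + a * h n / 2) (t + b * h n / 2) ltac:(lra) ltac:(lra)) as Q4.
      revert Z5; apply Rle_not_lt.
      eapply Rle_trans; [apply Rabs_triang4|].
      simpl in *. lra. }
    set (next := fun n z => proj1_sig (constructive_indefinite_description _ (step n z))).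
    set (z := fix z n := match n with O => (s0, t0) | S m => next m (z m) end).
    assert (HB : forall n, Bad n (z n)).
    { induction n as [|n IH].
      - unfold Bad, h; simpl fst; simpl snd; simpl pow. rewrite !Rmult_1_r in *. repeat split; lra.
      - simpl. unfold next. destruct (constructive_indefinite_description _ (step n (z n))) as [z' Hz']. apply Hz', IH. }
    assert (HN : forall n, Nested n (z n) (z (S n))).
    { intros n. simpl. unfold next. destruct (constructive_indefinite_description _ (step n (z n))) as [z' Hz']. apply Hz', HB. }
    destruct (nested_intervals (fun n => fst (z n)) a Ha) as (x & Hx); [intros n; destruct (HN n) as (N1 & N2 & _); split; assumption|].
    destruct (nested_intervals (fun n => snd (z n)) b Hb) as (y & Hy); [intros n; destruct (HN n) as (_ & _ & N1 & N2); split; assumption|].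
    assert (Hx0 : s0 <= x <= s0 + a) by (specialize (Hx 0%nat); simpl in Hx; lra).
    assert (Hy0 : t0 <= y <= t0 + b) by (specialize (Hy 0%nat); simpl in Hy; lra).
    destruct (circ_local u v s0 (s0 + a) t0 (t0 + b) x y eps H Hx0 Hy0 He) as (d & Hd & Hloc).
    (* Dividing by a + b + 1 makes both sides of the n-th rectangle shorter than d and avoids a zero
       denominator for degenerate rectangles. *)
    destruct (pow_lt_1_zero (/ 2) ltac:(rewrite Rabs_right; lra) (d / (a + b + 1))) as (n & Hn).
    { apply Rmult_lt_0_compat; [exact Hd|apply Rinv_0_lt_compat; lra]. }
    specialize (Hn n (le_n n)). fold (h n) in Hn. specialize (Hh n). rewrite Rabs_right in Hn by lra.
    assert (Hn' : h n * (a + b + 1) < d).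
    { apply Rmult_lt_compat_r with (r := a + b + 1) in Hn; [|lra].
      replace (d / (a + b + 1) * (a + b + 1)) with d in Hn by (field; lra). exact Hn. }
    destruct (HB n) as (B1 & B2 & B3 & B4 & B5).
    assert (0 <= a * h n) by (apply Rmult_le_pos; lra). assert (0 <= b * h n) by (apply Rmult_le_pos; lra).
    revert B5; apply Rle_not_lt, Hloc; try assumption; try lra; [apply Hx|apply Hy]. }
  assert (E : Rabs (circ u v s0 t0 a b) <= 0).
  { apply (Rle_eps _ _ ((a + b) ^ 2)); [apply pow2_ge_0|]. intros eps He; specialize (G eps He); lra. }
  pose proof (Rabs_pos (circ u v s0 t0 a b)). apply Rabs_eq_0; lra.
Qed.

(** * Chebyshev coefficients of analytic functions *)

Lemma cosh_sinh s : cosh s * cosh s = 1 + sinh s * sinh s.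
Proof.
  unfold cosh, sinh. assert (E : exp s * exp (- s) = 1) by (rewrite <- exp_plus, Rplus_opp_r; apply exp_0). nra.
Qed.

Lemma cosh_ge_1 s : 1 <= cosh s.
Proof.
  unfold cosh. assert (E : exp s * exp (- s) = 1) by (rewrite <- exp_plus, Rplus_opp_r; apply exp_0).
  pose proof (exp_pos s) as P1; pose proof (exp_pos (- s)) as P2.
  pose proof (pow2_ge_0 (exp s - exp (- s))) as P3.
  apply Rnot_lt_le; intros Hlt. nra.
Qed.

(** The distances of the point to the foci 1 and -1 are cosh s - cos t and cosh s + cos t, with sum
    2 cosh s = r + 1/r for r = exp s. The claim is then monotonicity of r + 1/r for r >= 1, read off
    from the factorisation [E]. *)
Lemma ellipse_param rho s t : 1 < rho -> 0 <= s -> exp s < rho ->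
  ellipse_interior rho (cosh s * cos t, sinh s * sin t).
Proof.
  intros Hr Hs He. unfold ellipse_interior.
  pose proof (cosh_sinh s) as HC. pose proof (cosh_ge_1 s) as HC1. pose proof (COS_bound t) as Hc.
  pose proof (sin2_cos2 t) as Ht; unfold Rsqr in Ht.
  replace (Cmod (((cosh s * cos t)%R, (sinh s * sin t)%R) - RtoC 1)%C) with (cosh s - cos t).
  2:{ unfold Cmod; simpl. symmetry; rewrite <- (sqrt_Rsqr (cosh s - cos t)) by lra. f_equal. unfold Rsqr.
      replace (sinh s * sin t + - 0) with (sinh s * sin t) by ring.
      transitivity (cosh s * cosh s * (cos t * cos t) - 2 * cosh s * cos t + 1 + (sinh s * sinh s) * (sin t * sin t)); [ring|].
      replace (sinh s * sinh s) with (cosh s * cosh s - 1) by lra.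
      replace (sin t * sin t) with (1 - cos t * cos t) by lra. ring. }
  replace (Cmod (((cosh s * cos t)%R, (sinh s * sin t)%R) + RtoC 1)%C) with (cosh s + cos t).
  2:{ unfold Cmod; simpl. symmetry; rewrite <- (sqrt_Rsqr (cosh s + cos t)) by lra. f_equal. unfold Rsqr.
      replace (sinh s * sin t + 0) with (sinh s * sin t) by ring.
      transitivity (cosh s * cosh s * (cos t * cos t) + 2 * cosh s * cos t + 1 + (sinh s * sinh s) * (sin t * sin t)); [ring|].
      replace (sinh s * sinh s) with (cosh s * cosh s - 1) by lra.
      replace (sin t * sin t) with (1 - cos t * cos t) by lra. ring. }
  assert (H1 : 1 <= exp s) by (rewrite <- exp_0; destruct Hs as [Hs|<-]; [left; apply exp_increasing, Hs|lra]).
  unfold cosh. rewrite exp_Ropp. set (r := exp s) in *.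
  assert (E : rho + / rho - (r + / r) = (rho - r) * (1 - / (rho * r))) by (field; lra).
  assert (/ (rho * r) < 1) by (rewrite <- Rinv_1; apply Rinv_lt_contravar; nra).
  assert (0 < (rho - r) * (1 - / (rho * r))) by (apply Rmult_lt_0_compat; lra). lra.
Qed.

Lemma diff2_eq f x y a b b' : differentiable_pt_lim f x y a b -> b = b' -> differentiable_pt_lim f x y a b'.
Proof. intros H <-; exact H. Qed.

(* With [z = (exp (s + i t) + exp (- (s + i t))) / 2], the functions [u] and [v] are the real and
   imaginary parts of [f z * exp (- k (s + i t))]. *)
Lemma closed_form_joukowski f rho k S t0 t1 : 1 < rho -> exp S < rho ->
  (forall z, ellipse_interior rho z -> exists l, Cdiff f z l) ->
  let U := fun s t => Re (f (cosh s * cos t, sinh s * sin t)) in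
  let V := fun s t => Im (f (cosh s * cos t, sinh s * sin t)) in
  let c := fun s t => exp (- (k * s)) * cos (k * t) in
  let d := fun s t => exp (- (k * s)) * sin (k * t) in
  closed_form (fun s t => 1 * (U s t * c s t) + 1 * (V s t * d s t))
              (fun s t => 1 * (V s t * c s t) + (-1) * (U s t * d s t)) 0 S t0 t1.
Proof.
  intros Hr HS Hf U V c d x y Hx Hy.
  assert (Hel : ellipse_interior rho (cosh x * cos y, sinh x * sin y)).
  { apply ellipse_param; [exact Hr|lra|]. eapply Rle_lt_trans; [|exact HS].
    destruct (proj2 Hx) as [Hlt|E]; [left; apply exp_increasing, Hlt|right; rewrite E; reflexivity]. }
  destruct (Hf _ Hel) as (l & Hl). destruct (Cdiff_real f _ _ l Hl) as [HU HV].
  assert (Dcosh : is_derive cosh x (sinh x)) by (apply is_derive_Reals, derivable_pt_lim_cosh).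
  assert (Dsinh : is_derive sinh x (cosh x)) by (apply is_derive_Reals, derivable_pt_lim_sinh).
  assert (Dcos : is_derive cos y (- sin y)) by (apply is_derive_Reals, derivable_pt_lim_cos).
  assert (Dsin : is_derive sin y (cos y)) by (apply is_derive_Reals, derivable_pt_lim_sin).
  assert (Dexp : is_derive (fun s => exp (- (k * s))) x (- k * exp (- (k * x)))) by (auto_derive; [exact I|ring]).
  assert (Dck : is_derive (fun t => cos (k * t)) y (- k * sin (k * y))) by (auto_derive; [exact I|ring]).
  assert (Dsk : is_derive (fun t => sin (k * t)) y (k * cos (k * y))) by (auto_derive; [exact I|ring]).
  assert (HX := diff2_mult _ _ _ _ _ _ _ _ (diff2_fst cosh x y _ Dcosh) (diff2_snd cos x y _ Dcos)).
  assert (HY := diff2_mult _ _ _ _ _ _ _ _ (diff2_fst sinh x y _ Dsinh) (diff2_snd sin x y _ Dsin)).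
  assert (Hc := diff2_mult _ _ _ _ _ _ _ _ (diff2_fst _ x y _ Dexp) (diff2_snd _ x y _ Dck)).
  assert (Hd := diff2_mult _ _ _ _ _ _ _ _ (diff2_fst _ x y _ Dexp) (diff2_snd _ x y _ Dsk)).
  assert (HU' := differentiable_pt_lim_comp _ _ _ _ _ _ _ _ _ _ _ HU HX HY).
  assert (HV' := differentiable_pt_lim_comp _ _ _ _ _ _ _ _ _ _ _ HV HX HY).
  assert (Hu := diff2_lin 1 1 _ _ _ _ _ _ _ _ (diff2_mult _ _ _ _ _ _ _ _ HU' Hc) (diff2_mult _ _ _ _ _ _ _ _ HV' Hd)).
  assert (Hv := diff2_lin 1 (-1) _ _ _ _ _ _ _ _ (diff2_mult _ _ _ _ _ _ _ _ HV' Hc) (diff2_mult _ _ _ _ _ _ _ _ HU' Hd)).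
  (* The partial derivatives are read off from [Hu] and [Hv]. What remains is that the two
     candidates for the shared value p agree: the Cauchy-Riemann equation for the product, an
     identity of polynomials in the data. *)
  refine (ex_intro _ _ (ex_intro _ _ (ex_intro _ _ (conj Hu _)))).
  eapply diff2_eq; [exact Hv|cbv beta; ring].
Qed.

Lemma sin_cos_nat_2PI k y : sin (INR k * (2 * PI - y)) = - sin (INR k * y) /\
  cos (INR k * (2 * PI - y)) = cos (INR k * y).
Proof.
  replace (INR k * (2 * PI - y)) with (- (INR k * y) + 2 * INR k * PI) by ring.
  rewrite sin_period, cos_period, sin_neg, cos_neg; auto.
Qed.

Lemma int_reflect_2PI g : continuity g ->
  RInt g 0 (2 * PI) = RInt (fun t => g t + g (2 * PI - t)) 0 PI.
Proof.
  intros Hg. rewrite int_plus by ct. rewrite <- (int_Chasles g 0 PI (2 * PI) Hg). f_equal.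
  assert (E := RInt_comp_lin (V := R_CompleteNormedModule) g (-1) (2 * PI) PI 0).
  replace (-1 * PI + 2 * PI) with PI in E by ring. replace (-1 * 0 + 2 * PI) with (2 * PI) in E by ring.
  rewrite <- (E (ex_int g PI (2 * PI) Hg)).
  rewrite (int_ext_all _ (fun t => (-1) * g (2 * PI - t)) PI 0).
  - assert (Cg : continuity (fun t => g (2 * PI - t))) by ct.
    rewrite int_scal by exact Cg.
    assert (E2 := int_Chasles (fun t => g (2 * PI - t)) 0 PI 0 Cg).
    rewrite RInt_point in E2. unfold zero in E2; simpl in E2. lra.
  - intros t. unfold scal; simpl; unfold mult; simpl. f_equal; f_equal; ring.
Qed.

Lemma exp_neg_INR_mult k x : exp (- (INR k * x)) = / exp x ^ k.
Proof.
  rewrite exp_Ropp; f_equal. induction k as [|k IH]; [simpl; rewrite Rmult_0_l; apply exp_0|].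
  rewrite S_INR, Rmult_plus_distr_r, exp_plus, IH, Rmult_1_l. simpl; ring.
Qed.

(** The left side is the absolute real part of z * exp(- i t), and the square of the corresponding
    imaginary part is what is missing to |z|^2. *)
Lemma Cmod_rotation z t : Rabs (Re z * cos t + Im z * sin t) <= Cmod z.
Proof.
  unfold Cmod. rewrite <- sqrt_Rsqr_abs. apply sqrt_le_1_alt.
  pose proof (sin2_cos2 t) as E; unfold Rsqr in *. unfold Re, Im.
  pose proof (Rle_0_sqr (fst z * sin t - snd z * cos t)) as P; unfold Rsqr in P.
  replace (fst z ^ 2 + snd z ^ 2) with ((fst z ^ 2 + snd z ^ 2) * (sin t * sin t + cos t * cos t)) by (rewrite E; ring).
  nra.
Qed.

(** Goursat on [0, S] x [0, 2 PI] compares two vertical edges, as the horizontal ones cancel by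
    periodicity. The edge at 0 carries f(cos t) exp(- i k t) and gives 2A; the edge at S is bounded
    by 2 PI M / exp(S)^k. Since [f] is controlled only inside the open ellipse, [exp S] stays below
    [rho] and the value [rho] is reached by a limit. *)
Lemma chebcoef_analytic f rho M k : 1 < rho ->
  (forall z, ellipse_interior rho z -> exists l, Cdiff f z l) ->
  (forall z, ellipse_interior rho z -> Cmod (f z) <= M) ->
  Rabs (chebcoef (fun x => Re (f (RtoC x))) k) <= PI * M / rho ^ k.
Proof.
  intros Hr Hf HM. pose proof PI_RGT_0 as HPI.
  set (A := chebcoef (fun x => Re (f (RtoC x))) k).
  assert (G : forall S, 0 <= S -> exp S < rho -> exp S ^ k * Rabs A <= PI * M).
  { intros S HS0 HS.
    assert (CF := fun t0 t1 => closed_form_joukowski f rho (INR k) S t0 t1 Hr HS Hf). cbv zeta in CF.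
    match type of CF with forall _ _, closed_form ?u ?v _ _ _ _ => set (u0 := u) in *; set (v0 := v) in * end.
    assert (CI : circ u0 v0 0 0 S (2 * PI) = 0).
    { apply goursat; [exact HS0|lra|]. rewrite !Rplus_0_l; apply CF. }
    unfold circ in CI. rewrite !Rplus_0_l in CI.
    assert (Ev : RInt (fun x => v0 x (2 * PI)) 0 S = RInt (fun x => v0 x 0) 0 S).
    { apply int_ext_all; intros x; unfold v0. destruct (sin_cos_nat_2PI k 0) as [E1 E2].
      rewrite Rminus_0_r in E1, E2. rewrite E1, E2, sin_2PI, cos_2PI, !Rmult_0_r, sin_0, cos_0, !Rmult_0_r. ring. }
    rewrite Ev in CI.
    assert (C0 : continuity (fun y => u0 0 y)).
    { apply cont_of_continuous; intros y. destruct (CF y y 0 y ltac:(lra) ltac:(lra)) as (p & q & r & Hu & _).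
      exact (diff2_cont_snd u0 0 y p q Hu). }
    assert (E0 : RInt (fun y => u0 0 y) 0 (2 * PI) = 2 * A).
    { rewrite int_reflect_2PI by exact C0.
      (* At s = 0 the points t and 2 PI - t have the same real image cos t; the cosine terms add up
         and the sine terms cancel. *)
      assert (Ep : forall t, u0 0 t + u0 0 (2 * PI - t) = 2 * (Re (f (RtoC (cos t))) * cos (INR k * t))).
      { intros t; unfold u0. destruct (sin_cos_nat_2PI k t) as [E1 E2]. rewrite E1, E2.
        destruct (sin_cos_nat_2PI 1 t) as [_ E3]. change (INR 1) with 1 in E3. rewrite !Rmult_1_l in E3. rewrite E3.
        rewrite cosh_0, sinh_0, !Rmult_0_l, !Rmult_1_l, Rmult_0_r, Ropp_0, exp_0. unfold RtoC. ring. }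
      rewrite (int_ext_all _ _ 0 PI Ep). apply int_scal.
      apply (cont_ext (fun t => / 2 * (u0 0 t + u0 0 (2 * PI - t)))); [intros t; rewrite Ep; field|].
      apply (cont_mult (fun _ => / 2)); [apply cont_const|]. apply cont_plus; [exact C0|].
      apply (cont_comp (fun y => u0 0 y) (fun t => 2 * PI - t)); [exact C0|ct]. }
    assert (ES : Rabs (RInt (fun y => u0 S y) 0 (2 * PI)) <= (2 * PI - 0) * (M / exp S ^ k)).
    { apply abs_RInt_le_const; [lra|eapply closed_form_ex_u; [apply (CF 0 (2 * PI))|lra..]|].
      intros y _. unfold u0. rewrite exp_neg_INR_mult.
      set (z := f (cosh S * cos y, sinh S * sin y)).
      replace (1 * (Re z * (/ exp S ^ k * cos (INR k * y))) + 1 * (Im z * (/ exp S ^ k * sin (INR k * y))))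
        with ((Re z * cos (INR k * y) + Im z * sin (INR k * y)) * / exp S ^ k) by ring.
      assert (P : 0 < / exp S ^ k) by (apply Rinv_0_lt_compat, pow_lt, exp_pos).
      rewrite Rabs_mult, (Rabs_right (/ _)) by lra.
      apply Rmult_le_compat_r; [lra|]. eapply Rle_trans; [apply Cmod_rotation|].
      apply HM, ellipse_param; assumption. }
    assert (EA : RInt (fun y => u0 S y) 0 (2 * PI) = 2 * A).
    { rewrite <- E0. apply Rminus_diag_uniq.
      etransitivity; [|exact CI]. rring. }
    rewrite EA, Rabs_mult, (Rabs_right 2) in ES by lra.
    assert (P : 0 < exp S ^ k) by apply pow_lt, exp_pos.
    apply (Rmult_le_compat_l (exp S ^ k)) in ES; [|lra].
    replace (exp S ^ k * ((2 * PI - 0) * (M / exp S ^ k))) with (2 * (PI * M)) in ES by (field; lra). lra. }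
  assert (P : 0 < rho ^ k) by (apply pow_lt; lra).
  apply Rmult_le_reg_l with (1 := P). replace (rho ^ k * (PI * M / rho ^ k)) with (PI * M) by (field; lra).
  apply Rnot_lt_le; intros Hlt.
  (* The bound for r < rho passes to rho because r^k |A| is continuous in r; r is kept at least 1 so
     that S = ln r is nonnegative. *)
  assert (Ck : continuity (fun r => r ^ k * Rabs A)) by ct.
  destruct (proj1 (cont_eps _) Ck rho (rho ^ k * Rabs A - PI * M) ltac:(lra)) as (d & Hd & H).
  set (r := Rmax 1 (rho - d / 2)).
  assert (Hr1 : 1 <= r < rho /\ rho - d / 2 <= r).
  { unfold r; repeat split; [apply Rmax_l|apply Rmax_lub_lt; lra|apply Rmax_r]. }
  specialize (H r ltac:(apply Rabs_def1; lra)). apply Rabs_def2 in H.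
  specialize (G (ln r)). rewrite exp_ln in G by lra.
  assert (0 <= ln r).
  { destruct (proj1 (proj1 Hr1)) as [Hlt1|E1]; [left; rewrite <- ln_1; apply ln_increasing; lra|rewrite <- E1, ln_1; lra]. }
  specialize (G H0 ltac:(lra)). lra.
Qed.

(** * Absolutely continuous functions *)

Lemma is_derive_eps f x l : is_derive f x l <-> forall eps, 0 < eps ->
  exists d, 0 < d /\ forall y, Rabs (y - x) < d -> Rabs (f y - f x - l * (y - x)) <= eps * Rabs (y - x).
Proof.
  split.
  - intros [_ H] eps He. destruct (H x (fun P HP => HP) (mkposreal eps He)) as [d Hd].
    exists d; split; [apply cond_pos|]. intros y Hy. rewrite (Rmult_comm l). exact (Hd y Hy).
  - intros H. split; [apply is_linear_scal_l|]. intros z Hz eps.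
    rewrite <- (is_filter_lim_locally_unique _ _ Hz). destruct (H eps (cond_pos eps)) as (d & Hd & H1).
    exists (mkposreal d Hd). intros y Hy. specialize (H1 y Hy). rewrite (Rmult_comm l) in H1. exact H1.
Qed.

(** Cousin's lemma as an induction principle: the supremum c of the points reached from [a] is
    itself reached, and the local hypothesis at c leads beyond it unless c = b. Locally only
    intervals containing x have to be handled, as for a tagged partition. *)
Lemma interval_induction (Q : R -> R -> Prop) a b : a <= b ->
  (forall u v w, a <= u -> u <= v -> v <= w -> w <= b -> Q u v -> Q v w -> Q u w) ->
  (forall x, a <= x <= b -> exists d, 0 < d /\
     forall u v, a <= u -> u <= x -> x <= v -> v <= b -> v - u < d -> Q u v) ->
  Q a b.
Proof.
  intros Hab Htr Hloc.
  destruct (completeness (fun x => a <= x <= b /\ Q a x)) as (c & Hub & Hlub).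
  - exists b; intros x [Hx _]; lra.
  - exists a. destruct (Hloc a ltac:(lra)) as (d & Hd & H). split; [lra|apply H; lra].
  - assert (Hac : a <= c).
    { apply Hub. destruct (Hloc a ltac:(lra)) as (d & Hd & H). split; [lra|apply H; lra]. }
    assert (Hcb : c <= b) by (apply Hlub; intros x [Hx _]; lra).
    destruct (Hloc c ltac:(lra)) as (d & Hd & H).
    assert (Hx : exists x, (a <= x <= b /\ Q a x) /\ c - d / 2 < x).
    { apply NNPP; intros Hno. assert (c <= c - d / 2); [|lra].
      apply Hlub; intros x Hx. apply Rnot_lt_le; intros Hlt. apply Hno; exists x; auto. }
    destruct Hx as (x & [Hx HQ] & Hxc). assert (Hxc' : x <= c) by (apply Hub; auto).
    (* The interval from x > c - d/2 to v <= c + d/3 contains c and is shorter than d. *)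
    set (v := Rmin b (c + d / 3)).
    assert (Hv : v <= b /\ v <= c + d / 3 /\ c <= v) by
      (unfold v; repeat split; [apply Rmin_l|apply Rmin_r|apply Rmin_glb; lra]).
    assert (HQv : Q a v) by (apply (Htr a x v); try lra; [exact HQ|apply H; lra]).
    assert (v <= c) by (apply Hub; split; [lra|exact HQv]).
    assert (E : v = b); [|rewrite <- E; exact HQv].
    unfold v in *. destruct (Rle_dec b (c + d / 3)); [rewrite Rmin_left in * by lra; reflexivity|].
    rewrite Rmin_right in * by lra. lra.
Qed.

(** This and [total_increment] are convertible to the two folds in [abs_continuous_I11]. *)
Definition total_length (l : list (R * R)) : R :=
  fold_right (fun ab s => (snd ab - fst ab) + s) 0 l.

Definition total_increment (F : R -> R) (l : list (R * R)) : R :=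
  fold_right (fun ab s => Rabs (F (snd ab) - F (fst ab)) + s) 0 l.

Lemma total_length_app l1 l2 : total_length (l1 ++ l2)%list = total_length l1 + total_length l2.
Proof.
  induction l1 as [|ab l1 IH]; unfold total_length in *; simpl; [ring|]. rewrite IH; ring.
Qed.

Lemma total_increment_app F l1 l2 :
  total_increment F (l1 ++ l2)%list = total_increment F l1 + total_increment F l2.
Proof.
  induction l1 as [|ab l1 IH]; unfold total_increment in *; simpl; [ring|]. rewrite IH; ring.
Qed.

Lemma disjoint_from_le u v l : u <= v -> disjoint_from v l -> disjoint_from u l.
Proof. destruct l as [|[a b] l]; simpl; intros Huv H; [exact I|intuition lra]. Qed.

Lemma disjoint_from_app u v l1 l2 : u <= v -> disjoint_from u l1 ->
  List.Forall (fun ab => snd ab <= v) l1 -> disjoint_from v l2 -> disjoint_from u (l1 ++ l2)%list.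
Proof.
  revert u; induction l1 as [|[a b] l1 IH]; simpl; intros u Huv H1 HF H2.
  - apply (disjoint_from_le u v); assumption.
  - destruct H1 as (Ha & Hb & H1). inversion_clear HF. repeat split; try assumption.
    apply IH; assumption.
Qed.

Lemma disjoint_from_length u l : disjoint_from u l -> 0 <= total_length l.
Proof.
  revert u; induction l as [|[a b] l IH]; unfold total_length in *; simpl; intros u H; [lra|].
  destruct H as (Ha & Hb & H). specialize (IH b H). lra.
Qed.

(* Length of the part of the first [K] covering intervals to the left of [x], with multiplicity. *)
Definition cover_length (a b : nat -> R) (K : nat) (x : R) : R :=
  sumlt K (fun k => Rmax 0 (Rmin x (b k) - a k)).

(** Each summand is nondecreasing in x, so further covering intervals can only enlarge the
    increment. This lets two adjacent segments that used different finite subcovers be glued. *)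
Lemma cover_length_incr a b K K' x y : x <= y -> (K <= K')%nat ->
  cover_length a b K y - cover_length a b K x <= cover_length a b K' y - cover_length a b K' x.
Proof.
  intros Hxy HK. replace K' with (K + (K' - K))%nat by lia. unfold cover_length. rewrite !sumlt_app.
  assert (M : forall k, Rmax 0 (Rmin x (b k) - a k) <= Rmax 0 (Rmin y (b k) - a k)).
  { intros k. apply Rle_max_compat_l. assert (Rmin x (b k) <= Rmin y (b k)) by (apply Rle_min_compat_r, Hxy). lra. }
  assert (S := sumlt_le (K' - K) _ _ (fun i _ => M (K + i)%nat)). simpl in S. lra.
Qed.

Lemma cover_length_inside a b k u v : a k < u -> u <= v -> v < b k ->
  v - u <= cover_length a b (S k) v - cover_length a b (S k) u.
Proof.
  intros Hu Huv Hv.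
  assert (I := cover_length_incr a b 0 k u v Huv ltac:(lia)). unfold cover_length in *. simpl in *.
  rewrite !(Rmin_left _ (b k)), !Rmax_right by lra. lra.
Qed.

Lemma cover_length_bound a b K u v : (forall k, a k <= b k) ->
  cover_length a b K v - cover_length a b K u <= sumlt K (fun k => b k - a k).
Proof.
  intros Hab.
  assert (P1 : 0 <= cover_length a b K u).
  { apply Rle_trans with (sumlt K (fun _ => 0)); [rewrite sumlt_zero by auto; lra|].
    apply sumlt_le; intros; apply Rmax_l. }
  assert (P2 : cover_length a b K v <= sumlt K (fun k => b k - a k)).
  { apply sumlt_le; intros k _. specialize (Hab k). apply Rmax_lub; [lra|].
    pose proof (Rmin_r v (b k)); lra. }
  lra.
Qed.

(* Gauge argument: the points where [F' = h] contribute at most [M + eps] times the length, and the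
   exceptional points are swept up by finitely many disjoint intervals of small total length, over
   which absolute continuity controls the increments. *)
Lemma ac_mean_le (F h : R -> R) M a b : abs_continuous_I11 F ->
  ae_I11 (fun x => is_derive F x (h x)) -> -1 <= a -> a <= b -> b <= 1 ->
  (forall x, a <= x <= b -> h x <= M) -> F b - F a <= M * (b - a).
Proof.
  intros HAC (N & HN & Hder) Ha Hab Hb HM.
  apply (Rle_eps _ _ (b - a + 2)); [lra|]. intros eps He.
  destruct (HAC eps He) as (delta & Hdelta & Hac).
  set (L := M + eps). assert (HL := Rabs_pos L).
  assert (He' : 0 < eps / (Rabs L + 1)) by (apply Rmult_lt_0_compat; [lra|apply Rinv_0_lt_compat; lra]).
  (* The first bound makes the swept intervals admissible for absolute continuity; the second keeps
     [Rabs L] times their length below eps, which matters when L is negative. *)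
  destruct (HN (Rmin (delta / 2) (eps / (Rabs L + 1)))) as (ca & cb & Hc1 & Hc2 & Hc3).
  { apply Rmin_glb_lt; lra. }
  (* [l] collects the swept intervals inside [u, v]. Their length is charged to the cover, their
     increments are kept aside, and outside them [F] grows at rate at most [L]. *)
  set (Q := fun u v => exists K l, disjoint_from u l /\ List.Forall (fun ab => snd ab <= v) l /\
     total_length l <= cover_length ca cb K v - cover_length ca cb K u /\
     F v - F u <= L * (v - u - total_length l) + total_increment F l).
  assert (HQ : Q a b).
  { apply interval_induction; [exact Hab| |].
    - intros u v w Hu Huv Hvw Hw (K1 & l1 & D1 & F1 & B1 & I1) (K2 & l2 & D2 & F2 & B2 & I2).
      exists (Nat.max K1 K2), (l1 ++ l2)%list.
      assert (C1 := cover_length_incr ca cb K1 (Nat.max K1 K2) u v Huv ltac:(lia)).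
      assert (C2 := cover_length_incr ca cb K2 (Nat.max K1 K2) v w Hvw ltac:(lia)).
      rewrite total_length_app, total_increment_app. repeat split; [| |lra|lra].
      + apply (disjoint_from_app u v); assumption.
      + apply Forall_app; split; [|exact F2].
        eapply Forall_impl; [|exact F1]. simpl; intros; lra.
    - intros x Hx. destruct (classic (N x)) as [HNx|HNx].
      + destruct (Hc2 x HNx) as (k & Hk). exists (Rmin (x - ca k) (cb k - x)).
        split; [apply Rmin_glb_lt; lra|]. intros u v Hau Hux Hxv Hvb Hsm.
        pose proof (Rmin_l (x - ca k) (cb k - x)); pose proof (Rmin_r (x - ca k) (cb k - x)).
        exists (S k), ((u, v) :: nil)%list. unfold total_length, total_increment; simpl.
        repeat split; try lra.
        * apply List.Forall_cons; [simpl; lra|apply List.Forall_nil].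
        * assert (I := cover_length_inside ca cb k u v ltac:(lra) ltac:(lra) ltac:(lra)). lra.
        * pose proof (Rle_abs (F v - F u)). lra.
      + assert (Hd := Hder x ltac:(unfold I11; lra) HNx).
        destruct (proj1 (is_derive_eps _ _ _) Hd eps He) as (d & Hd0 & Hd1).
        exists d; split; [exact Hd0|]. intros u v Hau Hux Hxv Hvb Hsm.
        exists 0%nat, nil%list. unfold total_length, total_increment; simpl.
        repeat split; [constructor|unfold cover_length; simpl; lra|].
        specialize (HM x Hx).
        (* Straddling: since u <= x <= v, the errors eps * (x - u) and eps * (v - x) add up to eps *
           (v - u). *)
        assert (G1 := Hd1 u ltac:(apply Rabs_def1; lra)). assert (G2 := Hd1 v ltac:(apply Rabs_def1; lra)).
        rewrite (Rabs_left1 (u - x)) in G1 by lra. rewrite (Rabs_right (v - x)) in G2 by lra.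
        apply Rabs_le_between in G1. apply Rabs_le_between in G2.
        assert (h x * (v - u) <= M * (v - u)) by (apply Rmult_le_compat_r; lra). unfold L. lra. }
  destruct HQ as (K & l & D & Fl & B & I).
  assert (P := disjoint_from_length a l D).
  assert (Hlen : total_length l <= Rmin (delta / 2) (eps / (Rabs L + 1))).
  { eapply Rle_trans; [exact B|]. eapply Rle_trans; [apply cover_length_bound, Hc1|apply Hc3]. }
  assert (Hl1 : total_length l < delta) by (pose proof (Rmin_l (delta / 2) (eps / (Rabs L + 1))); lra).
  assert (Hl2 : Rabs L * total_length l <= eps).
  { assert (Hl3 : total_length l <= eps / (Rabs L + 1)) by (pose proof (Rmin_r (delta / 2) (eps / (Rabs L + 1))); lra).
    apply (Rmult_le_compat_l (Rabs L + 1)) in Hl3; [|lra].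
    replace ((Rabs L + 1) * (eps / (Rabs L + 1))) with eps in Hl3 by (field; lra). lra. }
  assert (Hvar : total_increment F l < eps).
  { apply Hac; [split; [apply (disjoint_from_le (-1) a); assumption|]|exact Hl1].
    eapply Forall_impl; [|exact Fl]. simpl; intros; lra. }
  assert (- L * total_length l <= Rabs L * total_length l).
  { apply Rmult_le_compat_r; [exact P|]. rewrite <- Rabs_Ropp. apply Rle_abs. }
  unfold L in *. lra.
Qed.

Lemma ac_opp F : abs_continuous_I11 F -> abs_continuous_I11 (fun x => - F x).
Proof.
  intros H eps He. destruct (H eps He) as (d & Hd & H1). exists d; split; [exact Hd|].
  intros l Hl Hlen. specialize (H1 l Hl Hlen). eapply Rle_lt_trans; [|exact H1]. right.
  clear. induction l as [|ab l IH]; simpl; [reflexivity|]. rewrite IH. f_equal.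
  rewrite <- Rabs_Ropp. f_equal. ring.
Qed.

Lemma ac_mean_ge (F h : R -> R) M a b : abs_continuous_I11 F ->
  ae_I11 (fun x => is_derive F x (h x)) -> -1 <= a -> a <= b -> b <= 1 ->
  (forall x, a <= x <= b -> M <= h x) -> M * (b - a) <= F b - F a.
Proof.
  intros HAC (N & HN & Hder) Ha Hab Hb HM.
  assert (G : - F b - - F a <= - M * (b - a)); [|lra].
  apply (ac_mean_le (fun x => - F x) (fun x => - h x) (- M)); try assumption.
  - apply ac_opp, HAC.
  - exists N; split; [exact HN|]. intros x Hx Hnx.
    apply (is_derive_opp (V := R_NormedModule) F x (h x)), Hder; assumption.
  - intros x Hx; specialize (HM x Hx); lra.
Qed.

(** The retraction of the line onto [-1,1]. Functions are controlled on [-1,1] only, while the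
    integration lemmas ask for continuity everywhere; composing with [clamp] supplies it and changes
    nothing after composition with cos. *)
Definition clamp (x : R) : R := Rmax (-1) (Rmin 1 x).

Lemma clamp_I11 x : I11 (clamp x).
Proof.
  unfold clamp, I11; split; [apply Rmax_l|apply Rmax_lub; [lra|apply Rmin_l]].
Qed.

Lemma clamp_id x : I11 x -> clamp x = x.
Proof. unfold clamp, I11; intros H. rewrite Rmin_right, Rmax_right by lra. reflexivity. Qed.

Lemma clamp_cos t : clamp (cos t) = cos t.
Proof. apply clamp_id, COS_bound. Qed.

Lemma clamp_lipschitz x y : Rabs (clamp x - clamp y) <= Rabs (x - y).
Proof.
  unfold clamp, Rmax, Rmin. repeat destruct Rle_dec; unfold Rabs; repeat destruct Rcase_abs; lra.
Qed.

Lemma cont_clamp F : (forall x eps, I11 x -> 0 < eps -> exists d, 0 < d /\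
    forall y, I11 y -> Rabs (y - x) < d -> Rabs (F y - F x) < eps) ->
  continuity (fun x => F (clamp x)).
Proof.
  intros H. apply cont_eps; intros x eps He.
  destruct (H (clamp x) eps (clamp_I11 x) He) as (d & Hd & H1). exists d; split; [exact Hd|].
  intros y Hy. apply H1; [apply clamp_I11|]. eapply Rle_lt_trans; [apply clamp_lipschitz|exact Hy].
Qed.

Lemma ac_cont F : abs_continuous_I11 F -> continuity (fun x => F (clamp x)).
Proof.
  intros H. apply cont_clamp. intros x eps Hx He. destruct (H eps He) as (d & Hd & H1).
  exists d; split; [exact Hd|]. intros y Hy Hxy. unfold I11 in *.
  destruct (Rle_dec x y) as [Hle|Hgt].
  - specialize (H1 ((x, y) :: nil)%list). simpl in H1. rewrite !Rplus_0_r in H1. apply H1.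
    + split; [simpl; lra|apply List.Forall_cons; [simpl; lra|apply List.Forall_nil]].
    + eapply Rle_lt_trans; [apply Rle_abs|exact Hxy].
  - specialize (H1 ((y, x) :: nil)%list). simpl in H1. rewrite !Rplus_0_r in H1.
    rewrite Rabs_minus_sym. apply H1.
    + split; [simpl; lra|apply List.Forall_cons; [simpl; lra|apply List.Forall_nil]].
    + rewrite Rabs_minus_sym in Hxy. eapply Rle_lt_trans; [apply Rle_abs|exact Hxy].
Qed.

(** Near x the continuous [h] lies within eps of h(x), so the mean value inequalities squeeze the
    increment of [F]. An almost everywhere derivative thus becomes a derivative at every point of
    [-1,1], one-sided at the ends. *)
Lemma ac_derive_within (F h : R -> R) x eps : abs_continuous_I11 F ->
  ae_I11 (fun x => is_derive F x (h x)) -> continuity (fun x => h (clamp x)) -> I11 x -> 0 < eps ->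
  exists d, 0 < d /\ forall y, I11 y -> Rabs (y - x) < d ->
    Rabs (F y - F x - h x * (y - x)) <= eps * Rabs (y - x).
Proof.
  intros HAC Hae Hh Hx He.
  destruct (proj1 (cont_eps _) Hh x eps He) as (d & Hd & H).
  exists d; split; [exact Hd|]. intros y Hy Hxy.
  assert (B : forall z, Rmin x y <= z <= Rmax x y -> h x - eps <= h z <= h x + eps).
  { intros z Hz. assert (Hz1 : I11 z /\ Rabs (z - x) < d).
    { unfold I11 in *. destruct (Rle_dec x y);
        [rewrite Rmin_left, Rmax_right in Hz by lra|rewrite Rmin_right, Rmax_left in Hz by lra];
        apply Rabs_def2 in Hxy; (split; [lra|apply Rabs_def1; lra]). }
    destruct Hz1 as [Hz1 Hz2]. specialize (H z Hz2). rewrite !clamp_id in H by assumption.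
    apply Rabs_def2 in H. lra. }
  unfold I11 in *. destruct (Rle_dec x y) as [Hle|Hgt].
  - rewrite Rmin_left, Rmax_right in B by lra.
    assert (U := ac_mean_le F h (h x + eps) x y HAC Hae ltac:(lra) ltac:(lra) ltac:(lra) (fun z Hz => proj2 (B z Hz))).
    assert (L := ac_mean_ge F h (h x - eps) x y HAC Hae ltac:(lra) ltac:(lra) ltac:(lra) (fun z Hz => proj1 (B z Hz))).
    rewrite (Rabs_right (y - x)) by lra. apply Rabs_le; lra.
  - rewrite Rmin_right, Rmax_left in B by lra.
    assert (U := ac_mean_le F h (h x + eps) y x HAC Hae ltac:(lra) ltac:(lra) ltac:(lra) (fun z Hz => proj2 (B z Hz))).
    assert (L := ac_mean_ge F h (h x - eps) y x HAC Hae ltac:(lra) ltac:(lra) ltac:(lra) (fun z Hz => proj1 (B z Hz))).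
    rewrite (Rabs_left (y - x)) by lra. apply Rabs_le; lra.
Qed.

(** The chain rule done by hand: where cos t = 1 or -1 only a one-sided derivative of [F] is at
    hand, and this suffices because cos stays in [-1,1]. *)
Lemma ac_derive_cos (F h : R -> R) t : abs_continuous_I11 F ->
  ae_I11 (fun x => is_derive F x (h x)) -> continuity (fun x => h (clamp x)) ->
  is_derive (fun s => F (cos s)) t (- sin t * h (cos t)).
Proof.
  intros HAC Hae Hh. apply is_derive_eps. intros eps He.
  assert (Dcos : is_derive cos t (- sin t)) by (apply is_derive_Reals, derivable_pt_lim_cos).
  set (H0 := h (cos t)). assert (HH := Rabs_pos H0).
  (* [Hc] below bounds |cos y - cos t| by 2 |y - t|, so eps / 4 contributes eps / 2; the
     linearisation error of cos contributes the other half. *)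
  destruct (ac_derive_within F h (cos t) (eps / 4) HAC Hae Hh (COS_bound t) ltac:(lra)) as (d1 & Hd1 & H1).
  assert (He2 : 0 < eps / (2 * (Rabs H0 + 1))) by (apply Rmult_lt_0_compat; [lra|apply Rinv_0_lt_compat; lra]).
  destruct (proj1 (is_derive_eps _ _ _) Dcos _ He2) as (d2 & Hd2 & H2).
  destruct (proj1 (is_derive_eps _ _ _) Dcos 1 Rlt_0_1) as (d3 & Hd3 & H3).
  exists (Rmin (d1 / 2) (Rmin d2 d3)). split; [repeat apply Rmin_glb_lt; lra|].
  intros y Hy. pose proof (Rmin_l (d1 / 2) (Rmin d2 d3)). pose proof (Rmin_r (d1 / 2) (Rmin d2 d3)).
  pose proof (Rmin_l d2 d3). pose proof (Rmin_r d2 d3).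
  specialize (H2 y ltac:(lra)). specialize (H3 y ltac:(lra)).
  assert (Hc : Rabs (cos y - cos t) <= 2 * Rabs (y - t)).
  { replace (cos y - cos t) with ((cos y - cos t - - sin t * (y - t)) + - sin t * (y - t)) by ring.
    eapply Rle_trans; [apply Rabs_triang|]. rewrite (Rabs_mult (- sin t)), Rabs_Ropp.
    assert (Rabs (sin t) <= 1) by (apply Rabs_le; pose proof (SIN_bound t); lra).
    pose proof (Rabs_pos (y - t)). assert (Rabs (sin t) * Rabs (y - t) <= 1 * Rabs (y - t)) by (apply Rmult_le_compat_r; lra). lra. }
  specialize (H1 (cos y) (COS_bound y) ltac:(lra)). fold H0 in H1.
  replace (F (cos y) - F (cos t) - - sin t * H0 * (y - t)) with
    ((F (cos y) - F (cos t) - H0 * (cos y - cos t)) + H0 * (cos y - cos t - - sin t * (y - t))) by ring.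
  eapply Rle_trans; [apply Rabs_triang|]. rewrite (Rabs_mult H0).
  assert (Rabs H0 * Rabs (cos y - cos t - - sin t * (y - t)) <= eps / 2 * Rabs (y - t)).
  { apply Rle_trans with ((Rabs H0 + 1) * (eps / (2 * (Rabs H0 + 1)) * Rabs (y - t))).
    - apply Rmult_le_compat; try apply Rabs_pos; [lra|exact H2].
    - right; field; lra. }
  assert (eps / 4 * Rabs (cos y - cos t) <= eps / 4 * (2 * Rabs (y - t))) by (apply Rmult_le_compat_l; lra).
  lra.
Qed.

Lemma cont_cos_of_clamp h : continuity (fun x => h (clamp x)) -> continuity (fun t => h (cos t)).
Proof.
  intros H. apply (cont_ext (fun t => h (clamp (cos t)))); [intros; rewrite clamp_cos; reflexivity|].
  apply (cont_comp (fun x => h (clamp x)) cos); [exact H|exact continuity_cos].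
Qed.

(** F(cos t) sin((k+1)t) vanishes at 0 and PI, so its derivative integrates to 0; the product sin t
    sin((k+1)t) is half the difference of the cosines of frequencies k and k + 2. *)
Lemma chebcoef_derive (F h : R -> R) k : abs_continuous_I11 F ->
  ae_I11 (fun x => is_derive F x (h x)) -> continuity (fun x => h (clamp x)) ->
  INR (S k) * chebcoef F (S k) = (chebcoef h k - chebcoef h (S (S k))) / 2.
Proof.
  intros HAC Hae Hh. assert (D := fun t => ac_derive_cos F h t HAC Hae Hh).
  assert (CF := cont_cos_of_clamp F (ac_cont F HAC)). assert (Ch := cont_cos_of_clamp h Hh).
  set (c := INR (S k)).
  assert (E : RInt (fun t => - sin t * h (cos t) * sin (c * t) + c * (F (cos t) * cos (c * t))) 0 PI = 0).
  { rewrite (int_FTC (fun t => F (cos t) * sin (c * t))).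
    - unfold c; rewrite sin_INR_PI, !Rmult_0_r, sin_0; rring.
    - intros t. replace (- sin t * h (cos t) * sin (c * t) + c * (F (cos t) * cos (c * t)))
        with (- sin t * h (cos t) * sin (c * t) + F (cos t) * (c * cos (c * t))) by ring.
      apply (is_derive_mult (K := R_AbsRing) (fun t => F (cos t)) (fun t => sin (c * t)));
        [apply D|auto_derive; [exact I|ring]|apply Rmult_comm].
    - ct. }
  rewrite (int_ext_all _ (fun t => (-1 / 2) * (h (cos t) * cos (INR k * t)) +
     (1 / 2 * (h (cos t) * cos (INR (S (S k)) * t)) + c * (F (cos t) * cos (c * t))))) in E.
  - rewrite int_plus, int_lin, int_scal in E by ct. fold (chebcoef h k) in E.
    unfold chebcoef in *. fold c. lra.
  - intros t. assert (ES : sin t * sin (c * t) = (cos (INR k * t) - cos (INR (S (S k)) * t)) / 2).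
    { unfold c. rewrite !S_INR. replace ((INR k + 1 + 1) * t) with ((INR k + 1) * t + t) by ring.
      replace (INR k * t) with ((INR k + 1) * t - t) by ring. rewrite cos_plus, cos_minus; lra. }
    replace (- sin t * h (cos t) * sin (c * t)) with (- (sin t * sin (c * t)) * h (cos t)) by ring.
    rewrite ES. field.
Qed.

(** * Chebyshev coefficients under bounded variation *)

Lemma chebcoef_clamp f k : chebcoef (fun x => f (clamp x)) k = chebcoef f k.
Proof. apply int_ext_all; intros t; rewrite clamp_cos; reflexivity. Qed.

Lemma chebcoef_lin a b f g k : continuity f -> continuity g ->
  chebcoef (fun x => a * f x + b * g x) k = a * chebcoef f k + b * chebcoef g k.
Proof.
  intros Hf Hg. unfold chebcoef. rewrite <- int_lin by ct. apply int_ext_all; intros; ring.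
Qed.

Lemma chebcoef_sum N (c : nat -> R) (f : nat -> R -> R) k : (forall i, continuity (f i)) ->
  chebcoef (fun x => sumlt N (fun i => c i * f i x)) k = sumlt N (fun i => c i * chebcoef (f i) k).
Proof.
  intros Hf. induction N as [|N IH]; simpl.
  - unfold chebcoef. rewrite (int_ext_all _ (fun _ => 0)) by (intros; ring). rewrite int_const; ring.
  - rewrite <- IH, <- (Rmult_1_l (chebcoef (fun x => sumlt N _) k)).
    rewrite <- chebcoef_lin; [|ct; apply Hf|apply Hf].
    apply int_ext_all; intros; ring.
Qed.

Lemma chebcoef_affine p q k : chebcoef (fun x => p * 1 + q * x) (S (S k)) = 0.
Proof.
  rewrite chebcoef_lin by ct. unfold chebcoef.
  rewrite (int_ext_all _ (fun t => cos (INR (S (S k)) * t))) by (intros; ring). rewrite int_cos_0_PI.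
  rewrite (int_ext_all _ (fun t => / 2 * cos (INR (S (S (S k))) * t) + / 2 * cos (INR (S k) * t)))
    by (intros; rewrite cos_cos_succ; field).
  rewrite int_lin by ct. rewrite !int_cos_0_PI; ring.
Qed.

(** * Hinge functions and piecewise linear interpolation *)

Definition hinge (c x : R) : R := Rmax 0 (x - c).

Lemma cont_hinge c : continuity (hinge c).
Proof.
  apply (cont_ext (fun x => (Rabs (x - c) + (x - c)) / 2)); [|ct].
  intros x; unfold hinge, Rmax, Rabs; destruct Rle_dec, Rcase_abs; lra.
Qed.

(** With c = cos al, the integrand is supported on [0, al]. Integrating by parts leaves no boundary
    term, since the hinge vanishes at al and the sine at 0. The remaining sines have amplitudes 1/n
    and 1/(n+2), bounded together by 2/n. *)
Lemma chebcoef_hinge c k : I11 c ->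
  Rabs (chebcoef (hinge c) (S (S k))) <= / (INR (S (S k)) * INR (S k)).
Proof.
  intros Hc. pose proof (acos_bound c) as Ha. set (al := acos c) in *.
  assert (Ec : cos al = c) by (apply cos_acos, Hc). rewrite <- Ec.
  assert (Ch := cont_hinge (cos al)).
  set (n := INR (S k)). assert (Hn : 1 <= n) by (unfold n; rewrite S_INR; pose proof (pos_INR k); lra).
  assert (En : INR (S (S k)) = n + 1) by (unfold n; rewrite (S_INR (S k)); reflexivity).
  unfold chebcoef. rewrite En.
  rewrite <- (int_Chasles _ 0 al PI) by ct.
  rewrite (int_ext (fun t => hinge (cos al) (cos t) * cos ((n + 1) * t)) (fun _ => 0) al PI); [|lra|].
  2:{ intros t Ht. unfold hinge. rewrite Rmax_left; [ring|].
      assert (cos t <= cos al) by (apply cos_decr_1; lra). lra. }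
  rewrite int_const.
  rewrite (int_ext (fun t => hinge (cos al) (cos t) * cos ((n + 1) * t))
     (fun t => (cos t - cos al) * cos ((n + 1) * t)) 0 al); [|lra|].
  2:{ intros t Ht. unfold hinge. rewrite Rmax_right; [ring|].
      assert (cos al <= cos t) by (apply cos_decr_1; lra). lra. }
  (* The antiderivative comes from that integration by parts, with sin t sin((n+1)t) split into
     cosines of frequencies n and n + 2. *)
  rewrite (int_FTC (fun t => (cos t - cos al) * sin ((n + 1) * t) / (n + 1) +
     / (2 * (n + 1)) * (sin (n * t) / n - sin ((n + 2) * t) / (n + 2)))); [| |ct].
  2:{ intros t. auto_derive; [exact I|].
      replace ((n + 2) * t) with ((n + 1) * t + t) by ring.
      replace (n * t) with ((n + 1) * t - t) by ring. rewrite cos_plus, cos_minus. field; lra. }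
  rewrite !Rmult_0_r, sin_0, cos_0, Rminus_diag.
  replace (0 * sin ((n + 1) * al) / (n + 1) + / (2 * (n + 1)) * (sin (n * al) / n - sin ((n + 2) * al) / (n + 2)) -
    ((1 - cos al) * 0 / (n + 1) + / (2 * (n + 1)) * (0 / n - 0 / (n + 2))) + 0)
    with (/ (2 * (n + 1)) * (sin (n * al) / n - sin ((n + 2) * al) / (n + 2))) by (field; lra).
  assert (P1 : 0 < / n) by (apply Rinv_0_lt_compat; lra).
  assert (P2 : 0 < / (n + 2)) by (apply Rinv_0_lt_compat; lra).
  assert (P3 : 0 < / (2 * (n + 1))) by (apply Rinv_0_lt_compat; lra).
  assert (P4 : / (n + 2) <= / n) by (apply Rinv_le_contravar; lra).
  rewrite Rabs_mult, (Rabs_right (/ (2 * (n + 1)))) by lra.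
  replace (/ ((n + 1) * n)) with (/ (2 * (n + 1)) * (2 * / n)) by (field; lra).
  apply Rmult_le_compat_l; [lra|]. unfold Rdiv.
  pose proof (SIN_bound (n * al)); pose proof (SIN_bound ((n + 2) * al)).
  apply Rabs_le; split; nra.
Qed.

(** There are N + 1 equal cells and N interior points, so the denominator never vanishes and
    interior points match jumps of slope. *)
Definition grid (N i : nat) : R := -1 + 2 * INR i / INR (S N).

Lemma grid_succ N i : grid N (S i) = grid N i + 2 / INR (S N).
Proof. unfold grid. rewrite (S_INR i). field. apply not_0_INR; lia. Qed.

Lemma grid_0 N : grid N 0 = -1.
Proof. unfold grid; simpl (INR 0); field. apply not_0_INR; lia. Qed.

Lemma grid_last N : grid N (S N) = 1.
Proof. unfold grid; field. apply not_0_INR; lia. Qed.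

Lemma grid_step_pos N : 0 < 2 / INR (S N).
Proof. apply Rmult_lt_0_compat; [lra|apply Rinv_0_lt_compat, lt_0_INR; lia]. Qed.

Lemma grid_le N i j : (i <= j)%nat -> grid N i <= grid N j.
Proof.
  induction 1 as [|j Hij IH]; [lra|]. rewrite grid_succ. pose proof (grid_step_pos N); lra.
Qed.

Lemma grid_locate N x m : (1 <= m)%nat -> -1 <= x -> x <= grid N m ->
  exists j, (j < m)%nat /\ grid N j <= x <= grid N (S j).
Proof.
  intros Hm Hx. induction Hm as [|m Hm IH]; intros Hxm.
  - exists 0%nat. rewrite grid_0. split; [lia|lra].
  - destruct (Rle_dec x (grid N m)) as [Hle|Hgt].
    + destruct (IH Hle) as (j & Hj & H). exists j; split; [lia|exact H].
    + exists m; split; [lia|lra].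
Qed.

Definition slope (F : R -> R) (N i : nat) : R :=
  (F (grid N (S i)) - F (grid N i)) / (2 / INR (S N)).

(** The piecewise linear interpolant of [F] on the grid, written as an affine function plus hinges
    whose coefficients are the jumps of slope. The explicit factors 1 match the linear combinations
    in [chebcoef_lin]. *)
Definition interpolant (F : R -> R) (N : nat) (x : R) : R :=
  1 * ((F (-1) + slope F N 0) * 1 + slope F N 0 * x) +
  1 * sumlt N (fun i => (slope F N (S i) - slope F N i) * hinge (grid N (S i)) x).

(** On cell j the hinges further right vanish and those further left are affine, so the sum of jumps
    telescopes to the slope of the cell. *)
Lemma interpolant_eq F N j x : (j <= N)%nat -> grid N j <= x <= grid N (S j) ->
  interpolant F N x = F (grid N j) + slope F N j * (x - grid N j).
Proof.
  intros Hj Hx. unfold interpolant. replace N with (j + (N - j))%nat at 3 by lia.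
  rewrite sumlt_app, (sumlt_zero (N - j)).
  2:{ intros i _. unfold hinge. rewrite Rmax_left; [ring|].
      pose proof (grid_le N (S j) (S (j + i)) ltac:(lia)). lra. }
  rewrite (sumlt_ext j _ (fun i => (slope F N (S i) - slope F N i) * (x - grid N (S i)))).
  2:{ intros i Hi. unfold hinge. rewrite Rmax_right; [reflexivity|].
      pose proof (grid_le N (S i) j ltac:(lia)). lra. }
  clear Hj Hx. induction j as [|j IH].
  - simpl. rewrite grid_0; ring.
  - cbn [sumlt]. assert (E : slope F N j * (2 / INR (S N)) = F (grid N (S j)) - F (grid N j)).
    { unfold slope. pose proof (grid_step_pos N). field. apply not_0_INR; lia. }
    pose proof (grid_succ N j) as E2.
    replace (2 / INR (S N)) with (grid N (S j) - grid N j) in E by lra.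
    lra.
Qed.

Lemma cont_interpolant F N : continuity (interpolant F N).
Proof. unfold interpolant. ct; apply cont_hinge. Qed.

Lemma interpolant_approx F eps : continuity (fun x => F (clamp x)) -> 0 < eps ->
  exists N, forall x, I11 x -> Rabs (F x - interpolant F N x) <= 2 * eps.
Proof.
  intros HF He. destruct (cont_uniform _ (-1) 1 eps HF He) as (d & Hd & H).
  destruct (INR_unbounded (2 / d)) as (N & HN). exists N. intros x Hx.
  assert (HS : 2 / INR (S N) < d).
  { assert (0 < INR (S N)) by (apply lt_0_INR; lia). apply Rmult_lt_reg_r with (INR (S N)); [assumption|].
    replace (2 / INR (S N) * INR (S N)) with 2 by (field; lra). rewrite S_INR in *.
    apply Rmult_lt_compat_r with (r := d) in HN; [|exact Hd].
    replace (2 / d * d) with 2 in HN by (field; lra). lra. }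
  destruct (grid_locate N x (S N)) as (j & Hj & Hxj); [lia|apply Hx|rewrite grid_last; apply Hx|].
  rewrite (interpolant_eq F N j) by (assumption || lia).
  pose proof (grid_step_pos N) as Hs. pose proof (grid_succ N j) as Eg.
  assert (L0 := grid_le N 0 j ltac:(lia)). rewrite grid_0 in L0.
  assert (L1 := grid_le N (S j) (S N) ltac:(lia)). rewrite grid_last in L1.
  assert (G1 := H x (grid N j) Hx ltac:(lra) ltac:(apply Rabs_def1; lra)).
  assert (G2 := H (grid N (S j)) (grid N j) ltac:(lra) ltac:(lra) ltac:(apply Rabs_def1; lra)).
  rewrite !clamp_id in G1 by (unfold I11; lra). rewrite !clamp_id in G2 by (unfold I11; lra).
  replace (F x - (F (grid N j) + slope F N j * (x - grid N j))) with
    ((F x - F (grid N j)) + - ((F (grid N (S j)) - F (grid N j)) * ((x - grid N j) / (2 / INR (S N))))).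
  2:{ unfold slope. field. apply not_0_INR; lia. }
  eapply Rle_trans; [apply Rabs_triang|]. rewrite Rabs_Ropp, Rabs_mult.
  assert (T : 0 <= (x - grid N j) / (2 / INR (S N)) <= 1).
  { split; [apply Rmult_le_pos; [lra|apply Rlt_le, Rinv_0_lt_compat, Hs]|].
    apply Rmult_le_reg_r with (1 := Hs). unfold Rdiv at 1. rewrite Rmult_assoc, Rinv_l by lra. lra. }
  rewrite (Rabs_right (_ / (_ / _))) by lra.
  pose proof (Rabs_pos (F (grid N (S j)) - F (grid N j))). nra.
Qed.

(** The substitute for the mean value theorem when [h] is merely an almost everywhere derivative: if
    [h] stayed below s - eta, or above s + eta, the mean value inequalities would contradict the
    slope s. The points lie in the open interval so that choices from successive cells are strictly
    increasing. *)
Lemma ac_slope_attained (F h : R -> R) a b s eta : abs_continuous_I11 F ->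
  ae_I11 (fun x => is_derive F x (h x)) -> -1 <= a -> a < b -> b <= 1 -> 0 < eta ->
  F b - F a = s * (b - a) ->
  (exists y, a < y < b /\ s - eta <= h y) /\ (exists y, a < y < b /\ h y <= s + eta).
Proof.
  intros HAC Hae Ha Hab Hb He Hs.
  (* The mean value inequalities need closed intervals, so [[a,b]] is shrunk slightly. *)
  assert (Hshrink : exists a' b', a < a' /\ a' < b' /\ b' < b /\
     Rabs (F b' - F a' - s * (b' - a')) < eta * (b' - a')).
  (* Two endpoint errors of eta * (b - a) / 8 stay below eta * (b - a) / 2, and the shrunk interval
     keeps at least half the length. *)
  { assert (He8 : 0 < eta * (b - a) / 8) by (assert (0 < eta * (b - a)) by (apply Rmult_lt_0_compat; lra); lra).
    assert (CF := ac_cont F HAC).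
    assert (CG : continuity (fun x => F (clamp x) - s * x)) by ct.
    destruct (proj1 (cont_eps _) CG a _ He8) as (d1 & Hd1 & H1).
    destruct (proj1 (cont_eps _) CG b _ He8) as (d2 & Hd2 & H2).
    set (t := Rmin ((b - a) / 4) (Rmin (d1 / 2) (d2 / 2))).
    assert (Ht : 0 < t /\ t <= (b - a) / 4 /\ t <= d1 / 2 /\ t <= d2 / 2).
    { unfold t. split; [repeat apply Rmin_glb_lt; lra|]. split; [apply Rmin_l|].
      split; (eapply Rle_trans; [apply Rmin_r|]); [apply Rmin_l|apply Rmin_r]. }
    exists (a + t), (b - t). repeat split; try lra.
    specialize (H1 (a + t) ltac:(apply Rabs_def1; lra)). specialize (H2 (b - t) ltac:(apply Rabs_def1; lra)).
    rewrite !clamp_id in H1 by (unfold I11; lra). rewrite !clamp_id in H2 by (unfold I11; lra).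
    apply Rabs_def2 in H1. apply Rabs_def2 in H2.
    assert (eta * ((b - a) / 2) <= eta * (b - t - (a + t))) by (apply Rmult_le_compat_l; lra).
    apply Rabs_def1; lra. }
  destruct Hshrink as (a' & b' & H1 & H2 & H3 & H4). apply Rabs_def2 in H4.
  split; apply NNPP; intros Hno.
  - assert (G := ac_mean_le F h (s - eta) a' b' HAC Hae ltac:(lra) ltac:(lra) ltac:(lra)).
    assert (F b' - F a' <= (s - eta) * (b' - a')); [|lra].
    apply G; intros x Hx. apply Rnot_lt_le; intros Hlt. apply Hno; exists x; lra.
  - assert (G := ac_mean_ge F h (s + eta) a' b' HAC Hae ltac:(lra) ltac:(lra) ltac:(lra)).
    assert ((s + eta) * (b' - a') <= F b' - F a'); [|lra].
    apply G; intros x Hx. apply Rnot_lt_le; intros Hlt. apply Hno; exists x; lra.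
Qed.

(* [y |-> |z - y| + |y - w|] is convex, so moving [y] from [s] to one of two values on either side
   does not decrease it. *)
Lemma variation_select (P : R -> Prop) (h : R -> R) s eta : 0 < eta ->
  (exists y, P y /\ s - eta <= h y) -> (exists y, P y /\ h y <= s + eta) ->
  forall z w, exists y, P y /\ Rabs (z - s) + Rabs (s - w) <= Rabs (z - h y) + Rabs (h y - w) + 2 * eta.
Proof.
  intros He (y1 & P1 & H1) (y2 & P2 & H2) z w.
  destruct (Rle_dec ((z + w) / 2) s) as [Hle|Hgt].
  - exists y1; split; [exact P1|]. revert H1; generalize (h y1); intros p Hp.
    unfold Rabs; repeat destruct Rcase_abs; lra.
  - exists y2; split; [exact P2|]. revert H2; generalize (h y2); intros p Hp.
    unfold Rabs; repeat destruct Rcase_abs; lra.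
Qed.

(** Slopes are replaced by values of [h] from the right end to the left. The number [z] is the value
    already chosen to the right of index j, and the term with [z] is the pending link of the chain;
    each replacement costs at most 2 * eta by [variation_select]. *)
Lemma variation_choice (P : nat -> R -> Prop) (h : R -> R) (s : nat -> R) eta n : 0 < eta ->
  (forall i, (i <= n)%nat -> (exists y, P i y /\ s i - eta <= h y) /\ (exists y, P i y /\ h y <= s i + eta)) ->
  forall j, (j <= n)%nat -> forall z, exists sg : nat -> R, (forall i, (i <= j)%nat -> P i (sg i)) /\
    sumlt j (fun i => Rabs (s (S i) - s i)) + Rabs (z - s j) <=
    sumlt j (fun i => Rabs (h (sg (S i)) - h (sg i))) + Rabs (z - h (sg j)) + 2 * INR (S j) * eta.
Proof.
  intros He H j; induction j as [|j IH]; intros Hj z.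
  - destruct (H 0%nat Hj) as [A1 A2].
    destruct (variation_select (P 0%nat) h (s 0%nat) eta He A1 A2 z z) as (y & Py & Hy).
    exists (fun _ => y). split; [intros i Hi; replace i with 0%nat by lia; exact Py|].
    simpl. rewrite (Rabs_minus_sym (s 0%nat) z), (Rabs_minus_sym (h y) z) in Hy. lra.
  - destruct (H (S j) Hj) as [A1 A2].
    destruct (variation_select (P (S j)) h (s (S j)) eta He A1 A2 z (s j)) as (y & Py & Hy).
    destruct (IH ltac:(lia) (h y)) as (sg & Hsg & Hsum).
    exists (fun i => if le_dec i j then sg i else y). split.
    + intros i Hi. destruct (le_dec i j); [apply Hsg; assumption|replace i with (S j) by lia; exact Py].
    + cbn [sumlt]. destruct (le_dec (S j) j); [lia|]. destruct (le_dec j j); [|lia].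
      rewrite (sumlt_ext j (fun i => Rabs (h (if le_dec (S i) j then _ else _) - _))
        (fun i => Rabs (h (sg (S i)) - h (sg i)))).
      * rewrite S_INR. lra.
      * intros i Hi. destruct (le_dec (S i) j); [|lia]. destruct (le_dec i j); [reflexivity|lia].
Qed.

(** Adding the end points -1 and 1 to the chosen points gives a partition; its first and last terms
    are nonnegative and dropped. *)
Lemma variation_inner h V N (sg : nat -> R) : total_variation_I11 h V ->
  (forall i, (i <= N)%nat -> grid N i < sg i < grid N (S i)) ->
  sumlt N (fun i => Rabs (h (sg (S i)) - h (sg i))) <= V.
Proof.
  intros [Hub _] Hsg.
  set (t := fun i => match i with O => -1 | S i => if le_dec i N then sg i else 1 end).
  apply Rle_trans with (sumlt (S (S N)) (fun i => Rabs (h (t (S i)) - h (t i)))).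
  - set (f := fun i => Rabs (h (t (S i)) - h (t i))).
    change (sumlt (S (S N)) f) with (sumlt (S N) f + f (S N)). rewrite sumlt_S_l. unfold f.
    rewrite (sumlt_ext N (fun i => Rabs (h (t (S (S i))) - h (t (S i)))) (fun i => Rabs (h (sg (S i)) - h (sg i)))).
    + pose proof (Rabs_pos (h (t 1%nat) - h (t 0%nat))). pose proof (Rabs_pos (h (t (S (S N))) - h (t (S N)))). lra.
    + intros i Hi. unfold t. destruct (le_dec (S i) N); [|lia]. destruct (le_dec i N); [reflexivity|lia].
  - apply Hub. exists (S (S N)), t. split; [|reflexivity].
    unfold t. split; [reflexivity|split].
    + destruct (le_dec (S N) N); [lia|reflexivity].
    + intros [|i] Hi.
      * destruct (le_dec 0 N); [|lia]. specialize (Hsg 0%nat ltac:(lia)). rewrite grid_0 in Hsg. lra.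
      * destruct (le_dec i N); [|lia]. assert (A1 := Hsg i ltac:(lia)). destruct (le_dec (S i) N).
        -- specialize (Hsg (S i) ltac:(lia)). lra.
        -- replace i with N in * by lia. rewrite grid_last in A1. lra.
Qed.

Lemma variation_nonneg h V : total_variation_I11 h V -> 0 <= V.
Proof.
  intros [Hub _]. eapply Rle_trans; [|apply Hub; exists 1%nat, (fun i => -1 + 2 * INR i);
    split; [split; [simpl; ring|split; [simpl; ring|]]|reflexivity]].
  - simpl. pose proof (Rabs_pos (h (-1 + 2 * 1) - h (-1 + 2 * 0))). lra.
  - intros i _. rewrite S_INR. lra.
Qed.

Lemma slope_variation (F h : R -> R) V N : abs_continuous_I11 F ->
  ae_I11 (fun x => is_derive F x (h x)) -> total_variation_I11 h V ->
  sumlt N (fun i => Rabs (slope F N (S i) - slope F N i)) <= V.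
Proof.
  intros HAC Hae HV. destruct N as [|N]; [apply (variation_nonneg h), HV|].
  set (M := S N). apply (Rle_eps _ _ (2 * INR M + 2)); [pose proof (pos_INR M); lra|]. intros eta He.
  assert (A : forall i, (i <= M)%nat ->
    (exists y, grid M i < y < grid M (S i) /\ slope F M i - eta <= h y) /\
    (exists y, grid M i < y < grid M (S i) /\ h y <= slope F M i + eta)).
  { intros i Hi. pose proof (grid_step_pos M) as Hs. pose proof (grid_succ M i) as Eg.
    assert (L0 := grid_le M 0 i ltac:(lia)). rewrite grid_0 in L0.
    assert (L1 := grid_le M (S i) (S M) ltac:(lia)). rewrite grid_last in L1.
    apply (ac_slope_attained F h); try assumption; try lra.
    rewrite Eg at 2. unfold slope. field. apply not_0_INR; lia. }
  destruct (A M ltac:(lia)) as [AM1 AM2].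
  (* The last cell has no right neighbour: taking both neighbours equal to the preceding slope
     doubles the estimate for the single link, at cost eta after halving. *)
  destruct (variation_select _ h (slope F M M) eta He AM1 AM2 (slope F M N) (slope F M N)) as (y & Py & Hy).
  destruct (variation_choice (fun i y => grid M i < y < grid M (S i)) h (slope F M) eta M He A N ltac:(lia) (h y))
    as (sg & Hsg & Hsum).
  assert (B := variation_inner h V M (fun i => if le_dec i N then sg i else y) HV).
  assert (B' := B ltac:(intros i Hi; cbv beta; destruct (le_dec i N); [apply Hsg; assumption|replace i with M by lia; exact Py])).
  clear B. unfold M in *. cbn [sumlt] in *.
  destruct (le_dec (S N) N); [lia|]. destruct (le_dec N N); [|lia].
  rewrite (sumlt_ext N (fun i => Rabs (h (if le_dec (S i) N then _ else _) - _))
        (fun i => Rabs (h (sg (S i)) - h (sg i)))) in B'.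
  - rewrite (Rabs_minus_sym (slope F (S N) N) (slope F (S N) (S N))), (Rabs_minus_sym (slope F (S N) N) (h y)) in Hy.
    set (S1 := slope F (S N) (S N)) in *. set (S0 := slope F (S N) N) in *. lra.
  - intros i Hi. destruct (le_dec (S i) N); [|lia]. destruct (le_dec i N); [reflexivity|lia].
Qed.

Lemma chebcoef_le f e k : continuity f -> (forall x, I11 x -> Rabs (f x) <= e) ->
  Rabs (chebcoef f k) <= PI * e.
Proof.
  intros Hf H. pose proof PI_RGT_0. unfold chebcoef.
  replace (PI * e) with ((PI - 0) * e) by ring.
  apply abs_RInt_le_const; [lra|apply ex_int; ct|]. intros t _. rewrite Rabs_mult.
  specialize (H (cos t) (COS_bound t)).
  assert (Rabs (cos (INR k * t)) <= 1) by (apply Rabs_le, COS_bound).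
  pose proof (Rabs_pos (f (cos t))). pose proof (Rabs_pos (cos (INR k * t))). nra.
Qed.

(** The affine part of the interpolant is invisible to indices at least 2. Each hinge costs at most
    1 / (k (k - 1)) at index k, and the total of the jumps is at most [V]; the interpolation error
    tends to 0. *)
Lemma chebcoef_bv (F h : R -> R) V k : abs_continuous_I11 F ->
  ae_I11 (fun x => is_derive F x (h x)) -> total_variation_I11 h V ->
  Rabs (chebcoef F (S (S k))) <= V / (INR (S (S k)) * INR (S k)).
Proof.
  intros HAC Hae HV. assert (CF := ac_cont F HAC). pose proof PI_RGT_0 as HPI.
  assert (P : 0 < / (INR (S (S k)) * INR (S k))).
  { apply Rinv_0_lt_compat, Rmult_lt_0_compat; apply lt_0_INR; lia. }
  apply (Rle_eps _ _ (2 * PI)); [lra|]. intros eps He.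
  destruct (interpolant_approx F eps CF He) as (N & HN).
  assert (CL := cont_interpolant F N).
  rewrite <- chebcoef_clamp.
  replace (chebcoef (fun x => F (clamp x)) (S (S k))) with
    (1 * chebcoef (interpolant F N) (S (S k)) + 1 * chebcoef (fun x => F (clamp x) - interpolant F N x) (S (S k))).
  2:{ rewrite <- chebcoef_lin; [|exact CL|ct]. apply int_ext_all; intros; ring. }
  eapply Rle_trans; [apply Rabs_triang|]. rewrite !Rmult_1_l.
  apply Rplus_le_compat.
  - unfold interpolant. rewrite chebcoef_lin, chebcoef_affine, Rmult_0_r, Rplus_0_l, Rmult_1_l.
    2:{ ct. }
    2:{ ct. apply cont_hinge. }
    rewrite (chebcoef_sum N (fun i => slope F N (S i) - slope F N i) (fun i => hinge (grid N (S i))))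
      by (intros; apply cont_hinge).
    eapply Rle_trans; [apply sumlt_abs|]. unfold Rdiv.
    apply Rle_trans with (sumlt N (fun i => / (INR (S (S k)) * INR (S k)) * Rabs (slope F N (S i) - slope F N i))).
    + apply sumlt_le; intros i Hi. rewrite Rabs_mult, Rmult_comm. apply Rmult_le_compat_r; [apply Rabs_pos|].
      apply chebcoef_hinge. unfold I11.
      assert (L0 := grid_le N 0 (S i) ltac:(lia)). rewrite grid_0 in L0.
      assert (L1 := grid_le N (S i) (S N) ltac:(lia)). rewrite grid_last in L1. lra.
    + rewrite sumlt_scal, Rmult_comm. apply Rmult_le_compat_r; [lra|].
      apply (slope_variation F h); assumption.
  - replace (2 * PI * eps) with (PI * (2 * eps)) by ring. apply chebcoef_le; [ct|].
    intros x Hx. rewrite clamp_id by exact Hx. apply HN, Hx.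
Qed.

(** * Falling products, telescoping and iterated derivatives *)

Lemma prod1_pos m f : (forall j, (1 <= j <= m)%nat -> 0 < f j) -> 0 < prod1 m f.
Proof.
  induction m as [|m IH]; intros H; simpl; [lra|].
  apply Rmult_lt_0_compat; [apply IH; intros; apply H; lia|apply H; lia].
Qed.

Lemma prod1_S_l m f : prod1 (S m) f = f 1%nat * prod1 m (fun j => f (S j)).
Proof.
  induction m as [|m IH]; [simpl; ring|].
  change (prod1 (S m) f * f (S (S m)) = f 1%nat * (prod1 m (fun j => f (S j)) * f (S (S m)))).
  rewrite IH; ring.
Qed.

Lemma prod1_ext m f g : (forall j, f j = g j) -> prod1 m f = prod1 m g.
Proof. intros H; induction m as [|m IH]; simpl; [reflexivity|rewrite IH, H; reflexivity]. Qed.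

Definition falling (m : nat) (x : R) : R := prod1 m (fun j => x - INR j).

Lemma falling_pos m x : INR m < x -> 0 < falling m x.
Proof.
  intros H. apply prod1_pos; intros j Hj. assert (INR j <= INR m) by (apply le_INR; lia). lra.
Qed.

Lemma falling_succ m x : falling (S m) (x + 1) = x * falling m x.
Proof.
  unfold falling. rewrite prod1_S_l. change (INR 1) with 1.
  rewrite (prod1_ext m (fun j => x + 1 - INR (S j)) (fun j => x - INR j)) by (intros; rewrite S_INR; ring). ring.
Qed.

(** Telescoping of 1 / (x (x-1) ... (x-m)) = (1/m) (1 / [falling m x] - 1 / [falling m (x + 1)]).
    This is the origin of the factor 1/m in (ii). *)
Lemma falling_sum m n N : (1 <= m)%nat -> (m < n)%nat ->
  sumlt N (fun i => / (INR (n + i) * falling m (INR (n + i)))) <= / (INR m * falling m (INR n)).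
Proof.
  intros Hm Hmn. assert (Hm0 : 0 < INR m) by (apply lt_0_INR; lia).
  assert (E : sumlt N (fun i => / (INR (n + i) * falling m (INR (n + i)))) =
    / INR m * (/ falling m (INR n) - / falling m (INR (n + N)))).
  { induction N as [|N IH]; simpl; [rewrite Nat.add_0_r; ring|]. rewrite IH.
    rewrite Nat.add_succ_r, S_INR. set (x := INR (n + N)).
    assert (Hx : INR m < x) by (apply lt_INR; lia).
    assert (P1 := falling_pos m x Hx). assert (P2 := falling_pos m (x + 1) ltac:(lra)).
    assert (E := falling_succ m x). change (falling (S m) (x + 1)) with (falling m (x + 1) * (x + 1 - INR (S m))) in E.
    rewrite S_INR in E.
    assert (E2 : / falling m (x + 1) = (x - INR m) * / (x * falling m x)).
    { rewrite <- E. field. split; lra. }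
    assert (P3 := falling_pos m (INR n) ltac:(apply lt_INR; lia)).
    rewrite E2. field. repeat split; lra. }
  rewrite E, Rinv_mult. apply Rmult_le_compat_l; [apply Rlt_le, Rinv_0_lt_compat, Hm0|].
  assert (P : 0 < / falling m (INR (n + N))) by (apply Rinv_0_lt_compat, falling_pos, lt_INR; lia). lra.
Qed.

(** Induction from the derivative of order m - 1 down to order 0. Each use of [chebcoef_derive]
    divides by the index and replaces it by the two neighbouring ones, of which the lower has the
    weaker bound; this shifts the falling product by one and adds a factor. *)
Lemma chebcoef_smooth (Fd : nat -> R -> R) V m : (1 <= m)%nat ->
  (forall j, (j < m)%nat -> abs_continuous_I11 (Fd j)) ->
  (forall j, (j < m)%nat -> ae_I11 (fun x => is_derive (Fd j) x (Fd (S j) x))) ->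
  total_variation_I11 (Fd m) V ->
  forall k, (m < k)%nat -> Rabs (chebcoef (Fd O) k) <= V / (INR k * falling m (INR k)).
Proof.
  intros Hm HAC Hae HV. assert (HV0 := variation_nonneg _ _ HV).
  assert (G : forall i, (i < m)%nat -> forall k, (S i < k)%nat ->
    Rabs (chebcoef (Fd (m - S i)%nat) k) <= V / (INR k * falling (S i) (INR k))).
  { induction i as [|i IH]; intros Hi k Hk.
    - destruct k as [|[|k]]; try lia.
      replace (falling 1 (INR (S (S k)))) with (INR (S k)).
      + apply (chebcoef_bv _ (Fd m)); [apply HAC; lia| |exact HV].
        assert (H1 := Hae (m - 1)%nat ltac:(lia)). replace (S (m - 1)) with m in H1 by lia. exact H1.
      + unfold falling; cbn [prod1]. change (INR 1) with 1. rewrite (S_INR (S k)). ring.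
    - destruct k as [|k]; [lia|].
      assert (E : S (m - S (S i)) = (m - S i)%nat) by lia.
      assert (HR := chebcoef_derive (Fd (m - S (S i))%nat) (Fd (m - S i)%nat) k).
      assert (H1 := Hae (m - S (S i))%nat ltac:(lia)). rewrite E in H1.
      specialize (HR ltac:(apply HAC; lia) H1 ltac:(apply ac_cont, HAC; lia)).
      set (A := chebcoef (Fd (m - S (S i))%nat) (S k)) in *.
      assert (I1 := IH ltac:(lia) k ltac:(lia)). assert (I2 := IH ltac:(lia) (S (S k)) ltac:(lia)).
      rewrite <- (Rplus_0_r (INR k)) in I1.
      set (x := INR k) in *. assert (Hx : INR (S i) + 1 <= x).
      { unfold x. rewrite <- S_INR. apply le_INR; lia. }
      assert (Hi0 := pos_INR (S i)).
      rewrite !S_INR in I2. fold x in I2. rewrite Rplus_0_r in I1.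
      rewrite S_INR in HR |- *. fold x in HR |- *. rewrite falling_succ.
      assert (P1 : 0 < falling (S i) x) by (apply falling_pos; lra).
      (* The bound at index k + 2 is at most that at k, hence so is the mean of the two. *)
      assert (M2 : V / ((x + 1 + 1) * falling (S i) (x + 1 + 1)) <= V / (x * falling (S i) x)).
      { apply Rmult_le_compat_l; [exact HV0|]. apply Rinv_le_contravar; [apply Rmult_lt_0_compat; lra|].
        apply Rmult_le_compat; try lra. unfold falling.
        assert (Q : forall n, (n <= S i)%nat -> 0 < prod1 n (fun j => x - INR j) /\
           prod1 n (fun j => x - INR j) <= prod1 n (fun j => x + 1 + 1 - INR j)).
        { induction n as [|n IHn]; intros Hn; cbn [prod1]; [lra|]. destruct (IHn ltac:(lia)) as [Q1 Q2].
          assert (INR (S n) <= INR (S i)) by (apply le_INR, Hn).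
          split; [apply Rmult_lt_0_compat; lra|apply Rmult_le_compat; lra]. }
        apply Q; lia. }
      assert (B : Rabs ((x + 1) * A) <= V / (x * falling (S i) x)).
      { rewrite HR. unfold Rdiv at 1. rewrite Rabs_mult, (Rabs_right (/ 2)) by lra.
        assert (T := Rabs_triang (chebcoef (Fd (m - S i)%nat) k) (- chebcoef (Fd (m - S i)%nat) (S (S k)))).
        rewrite Rabs_Ropp in T. unfold Rminus at 1. lra. }
      rewrite Rabs_mult, (Rabs_right (x + 1)) in B by lra.
      apply Rmult_le_reg_l with (x + 1); [lra|].
      replace ((x + 1) * (V / ((x + 1) * (x * falling (S i) x)))) with (V / (x * falling (S i) x)) by (field; lra).
      exact B. }
  intros k Hk. specialize (G (m - 1)%nat ltac:(lia) k ltac:(lia)).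
  replace (S (m - 1)) with m in G by lia. rewrite Nat.sub_diag in G. exact G.
Qed.

(** * Remainder bounds *)

Lemma derive_within_cont (D : R -> Prop) f x l : is_derive_within D f x l -> forall eps, 0 < eps ->
  exists d, 0 < d /\ forall y, D y -> Rabs (y - x) < d -> Rabs (f y - f x) < eps.
Proof.
  intros H eps He. destruct (H (ball l (mkposreal 1 Rlt_0_1)) (locally_ball l (mkposreal 1 Rlt_0_1))) as [d Hd].
  assert (Hl := Rabs_pos l).
  exists (Rmin d (eps / (Rabs l + 1))). split.
  { apply Rmin_glb_lt; [apply cond_pos|]. apply Rmult_lt_0_compat; [lra|apply Rinv_0_lt_compat; lra]. }
  intros y Hy Hyx. destruct (Req_dec y x) as [->|Hne].
  { rewrite Rminus_diag, Rabs_R0; exact He. }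
  assert (Q := Hd y (Rlt_le_trans _ _ _ Hyx (Rmin_l _ _)) (conj Hy Hne)).
  change (Rabs ((f y - f x) / (y - x) - l) < 1) in Q.
  assert (Hd2 : Rabs (y - x) < eps / (Rabs l + 1)) by (eapply Rlt_le_trans; [exact Hyx|apply Rmin_r]).
  assert (Hq : Rabs ((f y - f x) / (y - x)) <= Rabs l + 1).
  { replace ((f y - f x) / (y - x)) with (((f y - f x) / (y - x) - l) + l) by ring.
    eapply Rle_trans; [apply Rabs_triang|]. lra. }
  replace (f y - f x) with ((f y - f x) / (y - x) * (y - x)) by (field; lra).
  rewrite Rabs_mult. pose proof (Rabs_pos (y - x)).
  apply Rle_lt_trans with ((Rabs l + 1) * Rabs (y - x)); [apply Rmult_le_compat_r; assumption|].
  apply Rmult_lt_compat_l with (r := Rabs l + 1) in Hd2; [|lra].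
  replace ((Rabs l + 1) * (eps / (Rabs l + 1))) with eps in Hd2 by (field; lra). exact Hd2.
Qed.

Lemma smooth_cont g : smooth_on_I11 g -> continuity (fun x => g (clamp x)).
Proof.
  intros (d & H0 & Hd). apply cont_clamp. intros x eps Hx He.
  destruct (derive_within_cont _ _ _ _ (Hd 0%nat x Hx) eps He) as (r & Hr & H1).
  exists r; split; [exact Hr|]. intros y Hy Hxy. rewrite <- !H0 by assumption. auto.
Qed.

Lemma null_set_empty : null_set (fun _ => False).
Proof.
  intros eps He. exists (fun _ => 0), (fun _ => 0). split; [intros; lra|split; [intros ? []|]].
  intros K. rewrite sumlt_zero; [lra|intros; ring].
Qed.

(** Since [phi] takes values in [-1,1], [g] may be replaced by its clamped extension, which makes
    the weight continuous on the whole line. A weight vanishing at every point of [-1,1] would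
    vanish almost everywhere, with the empty exceptional set. *)
Lemma oscillatory_weight g omega phi : (forall y, I11 y -> 0 <= g y) -> smooth_on_I11 g ->
  ((forall x, phi x = sin (omega * x)) \/ (forall x, phi x = cos (omega * x))) ->
  ~ ae_I11 (fun x => g (phi x) = 0) -> nonneg_weight (fun x => g (phi x)).
Proof.
  intros Hg Hs Hphi HW.
  assert (Hb : forall x, I11 (phi x)).
  { intros x; destruct Hphi as [E|E]; rewrite E; [apply SIN_bound|apply COS_bound]. }
  assert (Cphi : continuity phi).
  { destruct Hphi as [E|E]; [apply (cont_ext _ _ E)|apply (cont_ext _ _ E)]; ct. }
  assert (Cg := smooth_cont g Hs). split; [|split].
  - apply (cont_ext (fun x => g (clamp (phi x)))); [intros x; rewrite clamp_id by apply Hb; reflexivity|].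
    apply (cont_comp (fun x => g (clamp x)) phi); assumption.
  - intros t _; apply Hg, Hb.
  - apply NNPP; intros Hno. apply HW. exists (fun _ => False). split; [apply null_set_empty|].
    intros x Hx _. apply NNPP; intros Hne. apply Hno; exists x; auto.
Qed.

Lemma remainder_ext W n x w f h : (forall k, (k < n)%nat -> I11 (x k)) ->
  (forall t, I11 t -> f t = h t) -> remainder W n x w f = remainder W n x w h.
Proof.
  intros Hx E. unfold remainder. f_equal.
  - apply int_ext; [lra|]. intros t Ht; rewrite E by exact Ht; reflexivity.
  - apply sumlt_ext; intros k Hk; rewrite E by auto; reflexivity.
Qed.

Lemma Csumlt_pair n F : Csumlt n F = (sumlt n (fun k => fst (F k)), sumlt n (fun k => snd (F k))).
Proof. induction n as [|n IH]; simpl; [reflexivity|rewrite IH; reflexivity]. Qed.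

Lemma is_RInt_clamp W f : continuity W -> continuity (fun t => f (clamp t)) ->
  is_RInt (V := R_NormedModule) (fun t => f t * W t) (-1) 1 (RInt (fun t => f t * W t) (-1) 1).
Proof.
  intros HW Hf. apply (RInt_correct (V := R_CompleteNormedModule)).
  apply (ex_RInt_ext (V := R_NormedModule) (fun t => f (clamp t) * W t)).
  - rewrite Rmin_left, Rmax_right by lra. intros t Ht. rewrite clamp_id by (unfold I11; lra). reflexivity.
  - apply ex_int. apply (cont_mult (fun t => f (clamp t)) W); assumption.
Qed.

Lemma Cremainder_pair W n x w f : continuity W ->
  continuity (fun t => Re (f (RtoC (clamp t)))) -> continuity (fun t => Im (f (RtoC (clamp t)))) ->
  Cremainder W n x w f =
    (remainder W n x w (fun t => Re (f (RtoC t))), remainder W n x w (fun t => Im (f (RtoC t)))).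
Proof.
  intros HW H1 H2. unfold Cremainder, remainder. rewrite Csumlt_pair.
  assert (E : @RInt C_R_CompleteNormedModule (fun t => RtoC (W t) * f (RtoC t))%C (-1) 1 =
    (RInt (fun t => Re (f (RtoC t)) * W t) (-1) 1, RInt (fun t => Im (f (RtoC t)) * W t) (-1) 1)).
  { apply is_RInt_unique.
    apply (is_RInt_fct_extend_pair (U := R_NormedModule) (V := R_NormedModule)).
    - apply (is_RInt_ext (V := R_NormedModule) (fun t => Re (f (RtoC t)) * W t)).
      + intros t _. unfold Re; simpl. ring.
      + apply (is_RInt_clamp W (fun t => Re (f (RtoC t))) HW H1).
    - apply (is_RInt_ext (V := R_NormedModule) (fun t => Im (f (RtoC t)) * W t)).
      + intros t _. unfold Im; simpl. ring.
      + apply (is_RInt_clamp W (fun t => Im (f (RtoC t))) HW H2). }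
  rewrite E. unfold Cminus, Cplus, Copp; simpl.
  rewrite (sumlt_ext n (fun k => w k * fst (f (RtoC (x k))) - 0 * snd (f (RtoC (x k)))) (fun k => w k * Re (f (RtoC (x k)))))
    by (intros; unfold Re; ring).
  rewrite (sumlt_ext n (fun k => w k * snd (f (RtoC (x k))) + 0 * fst (f (RtoC (x k)))) (fun k => w k * Im (f (RtoC (x k)))))
    by (intros; unfold Im; ring).
  reflexivity.
Qed.

Lemma geometric_tail rho n N : 1 < rho ->
  sumlt N (fun i => / rho ^ (n + i)) <= / (rho ^ n * (1 - / rho)).
Proof.
  intros Hr. assert (Hi : / rho < 1) by (rewrite <- Rinv_1; apply Rinv_lt_contravar; lra).
  assert (P : forall k, 0 < / rho ^ k) by (intros k; apply Rinv_0_lt_compat, pow_lt; lra).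
  assert (E : (1 - / rho) * sumlt N (fun i => / rho ^ (n + i)) = / rho ^ n - / rho ^ (n + N)).
  { induction N as [|N IH]; simpl; [rewrite Nat.add_0_r; ring|].
    rewrite Rmult_plus_distr_l, IH, Nat.add_succ_r. simpl. field.
    split; [apply Rgt_not_eq, pow_lt; lra|split; [lra|apply Rgt_not_eq, pow_lt; lra]]. }
  apply Rmult_le_reg_l with (1 - / rho); [lra|]. rewrite E, Rinv_mult.
  replace ((1 - / rho) * (/ rho ^ n * / (1 - / rho))) with (/ rho ^ n).
  - specialize (P (n + N)%nat). lra.
  - rewrite (Rmult_comm (/ rho ^ n)), <- Rmult_assoc, Rinv_r by lra. ring.
Qed.

Lemma segment_in_ellipse rho x : 1 < rho -> I11 x -> ellipse_interior rho (RtoC x).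
Proof.
  intros Hr Hx. assert (H := ellipse_param rho 0 (acos x) Hr (Rle_refl 0) ltac:(rewrite exp_0; exact Hr)).
  rewrite cosh_0, sinh_0, Rmult_1_l, Rmult_0_l, cos_acos in H by exact Hx. exact H.
Qed.

Lemma Cdiff_cont_segment f rho : 1 < rho -> (forall z, ellipse_interior rho z -> exists l, Cdiff f z l) ->
  continuity (fun t => Re (f (RtoC (clamp t)))) /\ continuity (fun t => Im (f (RtoC (clamp t)))).
Proof.
  intros Hr Hf.
  assert (G : forall x, I11 x -> continuous (fun a => Re (f (a, 0))) x /\ continuous (fun a => Im (f (a, 0))) x).
  { intros x Hx. destruct (Hf _ (segment_in_ellipse rho x Hr Hx)) as (l & Hl).
    destruct (Cdiff_real f x 0 l Hl) as [H1 H2].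
    split; [exact (diff2_cont_fst _ _ _ _ _ H1)|exact (diff2_cont_fst _ _ _ _ _ H2)]. }
  split; apply (cont_clamp (fun a => _ (f (RtoC a)))); intros x eps Hx He; destruct (G x Hx) as [G1 G2].
  - destruct (proj1 (filterlim_locally _ _) G1 (mkposreal eps He)) as [d Hd].
    exists d; split; [apply cond_pos|]. intros y _ Hy. exact (Hd y Hy).
  - destruct (proj1 (filterlim_locally _ _) G2 (mkposreal eps He)) as [d Hd].
    exists d; split; [apply cond_pos|]. intros y _ Hy. exact (Hd y Hy).
Qed.

(** The factor is conj z / |z|. Rotating a complex remainder onto the real axis keeps the constant,
    whereas separate estimates of real and imaginary parts would lose a factor. *)
Lemma Cmod_as_Re z : exists c, Cmod c = 1 /\ Re (c * z)%C = Cmod z.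
Proof.
  destruct (Req_dec (Cmod z) 0) as [E|Hne].
  - exists (RtoC 1). split; [apply Cmod_1|]. rewrite (Cmod_eq_0 z E), Cmult_0_r, Cmod_0. reflexivity.
  - exists (Cconj z / RtoC (Cmod z))%C. assert (P := Cmod_ge_0 z).
    assert (E : (Cmod z * Cmod z = fst z * fst z + snd z * snd z)%R).
    { unfold Cmod. rewrite sqrt_sqrt; [ring|]. apply Rplus_le_le_0_compat; apply pow2_ge_0. }
    split.
    + rewrite Cmod_div by (intros E0; apply Hne; injection E0; auto).
      rewrite Cmod_conj, Cmod_R, Rabs_right by lra. field; exact Hne.
    + unfold Cdiv, Cinv, Re; simpl. unfold Re, Im.
      rewrite !Rmult_1_r, !Rmult_0_l, !Rplus_0_r.
      transitivity ((fst z * fst z + snd z * snd z) / Cmod z); [field; exact Hne|].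
      rewrite <- E. field; exact Hne.
Qed.

(** The unimodular [c] is chosen from the remainder itself; c * f satisfies the same hypotheses with
    the same [M], and the remainder of its real part is the modulus sought. *)
Lemma gauss_remainder_analytic W n x w rho M f : nonneg_weight W -> gauss_rule W n x w -> 1 < rho ->
  (forall z, ellipse_interior rho z -> exists l, Cdiff f z l) ->
  (forall z, ellipse_interior rho z -> Cmod (f z) <= M) ->
  Cmod (Cremainder W n x w f) <= 4 * RInt W (-1) 1 * M / (rho ^ (2 * n) * (1 - / rho)).
Proof.
  intros HW HG Hr Hf HM. destruct (Cdiff_cont_segment f rho Hr Hf) as [C1 C2]. pose proof PI_RGT_0 as HPI.
  assert (HM0 : 0 <= M).
  { eapply Rle_trans; [apply Cmod_ge_0|]. apply (HM (RtoC 0)), segment_in_ellipse; [exact Hr|unfold I11; lra]. }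
  assert (HC := proj1 HW). assert (Hx := gauss_nodes _ _ _ _ HW (gauss_exact _ _ _ _ HG)).
  rewrite (Cremainder_pair W n x w f HC C1 C2).
  set (r1 := remainder W n x w (fun t => Re (f (RtoC t)))). set (r2 := remainder W n x w (fun t => Im (f (RtoC t)))).
  destruct (Cmod_as_Re (r1, r2)) as (c & Hc1 & Hc2). rewrite <- Hc2.
  set (h := fun t => fst c * Re (f (RtoC (clamp t))) + - snd c * Im (f (RtoC (clamp t)))).
  assert (Ch : continuity h).
  { unfold h. apply cont_plus; apply cont_mult; try apply cont_const; assumption. }
  assert (E : Re (c * (r1, r2))%C = remainder W n x w h).
  { unfold h. rewrite remainder_lin by assumption.
    rewrite (remainder_ext W n x w (fun t => Re (f (RtoC (clamp t)))) (fun t => Re (f (RtoC t))) Hx)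
      by (intros t Ht; rewrite clamp_id by exact Ht; reflexivity).
    rewrite (remainder_ext W n x w (fun t => Im (f (RtoC (clamp t)))) (fun t => Im (f (RtoC t))) Hx)
      by (intros t Ht; rewrite clamp_id by exact Ht; reflexivity).
    fold r1 r2. unfold Re; simpl. ring. }
  rewrite E. eapply Rle_trans; [apply Rle_abs|].
  replace (4 * RInt W (-1) 1 * M / (rho ^ (2 * n) * (1 - / rho)))
    with (2 * RInt W (-1) 1 * (2 * M * / (rho ^ (2 * n) * (1 - / rho)))) by (unfold Rdiv; ring).
  apply (remainder_chebcoef W n x w h (fun k => 2 * M * / rho ^ k)); try assumption.
  - intros k _.
    assert (B := chebcoef_analytic (fun z => c * f z)%C rho M k Hr).
    replace (PI / 2 * (2 * M * / rho ^ k)) with (PI * M / rho ^ k) by (unfold Rdiv; field; apply Rgt_not_eq, pow_lt; lra).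
    replace (chebcoef h k) with (chebcoef (fun x => Re (c * f (RtoC x))%C) k).
    + apply B.
      * intros z Hz. destruct (Hf z Hz) as (l & Hl). exists (c * l)%C. apply Cdiff_scal, Hl.
      * intros z Hz. rewrite Cmod_mult, Hc1, Rmult_1_l. apply HM, Hz.
    + apply int_ext_all; intros t. unfold h. rewrite clamp_cos. unfold Re, Im; simpl. ring.
  - intros N. rewrite sumlt_scal. apply Rmult_le_compat_l; [lra|]. apply geometric_tail, Hr.
Qed.

(** The condition m < 2n puts every surviving index k >= 2n above m, where [chebcoef_smooth]
    applies, and makes all factors 2n - j positive. *)
Lemma gauss_remainder_bv W n x w m (f : R -> R) (Fd : nat -> R -> R) V : nonneg_weight W -> gauss_rule W n x w ->
  (1 <= m)%nat -> (m < 2 * n)%nat ->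
  (forall t, I11 t -> Fd O t = f t) ->
  (forall j, (j < m)%nat -> abs_continuous_I11 (Fd j)) ->
  (forall j, (j < m)%nat -> ae_I11 (fun t => is_derive (Fd j) t (Fd (S j) t))) ->
  total_variation_I11 (Fd m) V ->
  Rabs (remainder W n x w f) <= 4 * RInt W (-1) 1 * V / (PI * INR m * falling m (INR (2 * n))).
Proof.
  intros HW HG Hm Hmn Hf HAC Hae HV. pose proof PI_RGT_0 as HPI.
  assert (Hx := gauss_nodes _ _ _ _ HW (gauss_exact _ _ _ _ HG)).
  rewrite (remainder_ext W n x w f (fun t => Fd O (clamp t)) Hx)
    by (intros t Ht; rewrite clamp_id by exact Ht; symmetry; apply Hf, Ht).
  assert (Hm0 : 0 < INR m) by (apply lt_0_INR; lia).
  assert (HF := falling_pos m (INR (2 * n)) ltac:(apply lt_INR, Hmn)).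
  replace (4 * RInt W (-1) 1 * V / (PI * INR m * falling m (INR (2 * n))))
    with (2 * RInt W (-1) 1 * (2 / PI * V * / (INR m * falling m (INR (2 * n))))) by (field; repeat split; lra).
  apply (remainder_chebcoef W n x w _ (fun k => 2 / PI * V * / (INR k * falling m (INR k)))); try assumption.
  - apply ac_cont, HAC; lia.
  - intros k Hk. rewrite chebcoef_clamp.
    replace (PI / 2 * (2 / PI * V * / (INR k * falling m (INR k)))) with (V / (INR k * falling m (INR k))).
    + apply (chebcoef_smooth Fd V m); try assumption. lia.
    + assert (INR m < INR k) by (apply lt_INR; lia). assert (P := falling_pos m (INR k) H).
      field. repeat split; lra.
  - intros N. rewrite sumlt_scal. apply Rmult_le_compat_l.
    + apply Rmult_le_pos; [|apply (variation_nonneg _ _ HV)].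
      apply Rmult_le_pos; [lra|apply Rlt_le, Rinv_0_lt_compat, HPI].
    + apply falling_sum; assumption.
Qed.

Theorem theorem2p1
  (g : R -> R) (omega : R) (phi : R -> R)
  (Hg_nonneg : forall y, I11 y -> 0 <= g y)
  (Hg_smooth : smooth_on_I11 g)
  (Homega : 0 < omega)
  (Hphi : (forall x, phi x = sin (omega * x)) \/
          (forall x, phi x = cos (omega * x)))
  (HW : ~ ae_I11 (fun x => g (phi x) = 0)) :
  let W := fun x => g (phi x) in
  let K := RInt W (-1) 1 in
  (* (i) analytic integrands *)
  (forall (rho M : R) (f : C -> C),
     1 < rho ->
     analytic_on (ellipse_interior rho) f ->
     (forall z, ellipse_interior rho z -> Cmod (f z) <= M) ->
     forall (n : nat) (x w : nat -> R),
       gauss_rule W n x w ->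
       Cmod (Cremainder W n x w f) <= 4 * K * M / (rho ^ (2 * n) * (1 - / rho)))
  /\
  (* (ii) integrands with m-1 absolutely continuous derivatives and
     an m-th derivative of bounded variation V *)
  (forall (m : nat) (f : R -> R) (Fd : nat -> R -> R) (V : R),
     (1 <= m)%nat ->
     (forall x, I11 x -> Fd O x = f x) ->
     (forall j, (j < m)%nat -> abs_continuous_I11 (Fd j)) ->
     (forall j, (j < m)%nat ->
        ae_I11 (fun x => is_derive (Fd j) x (Fd (S j) x))) ->
     total_variation_I11 (Fd m) V ->
     forall (n : nat) (x w : nat -> R),
       ((m + 2) / 2 <= n)%nat ->
       gauss_rule W n x w ->
       Rabs (remainder W n x w f)
         <= 4 * K * V / (PI * INR m * prod1 m (fun j => INR (2 * n) - INR j))).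
Proof.
  intros W K.
  assert (HWt : nonneg_weight W) by (apply (oscillatory_weight g omega phi); assumption).
  split.
  - intros rho M f Hr Han HM n x w HG.
    apply gauss_remainder_analytic; try assumption.
    intros z Hz. apply ex_derive_Cdiff, Han, Hz.
  - intros m f Fd V Hm Hf HAC Hae HV n x w Hn HG.
    apply (gauss_remainder_bv W n x w m f Fd V); try assumption.
    (* From (m + 2) / 2 <= n one gets m + 2 <= 2n + 1, that is, m < 2n. *)
    pose proof (Nat.div_mod_eq (m + 2) 2). pose proof (Nat.mod_upper_bound (m + 2) 2 ltac:(lia)). lia.
Qed.
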